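(* Let $\Omega$ be a bounded domain in $\mathbb C$. Then: (1) If $K_p(a)=1/|\Omega|$ for some $a\in\Omega$ and some $0<p<2$, then $\Omega$ is a disc centred at $a$. (2) Suppose furthermore that $|\overline\Omega^{\circ}\setminus\Omega|=0$. If $K_p(a)=1/|\Omega|$ for some $a\in\Omega$ and some $2\le p<\infty$, then $\overline\Omega$ is a closed disc centred at $a$.
   Context: $|\cdot|$ denotes Lebesgue measure and $\overline\Omega^{\circ}$ the interior of the closure of $\Omega$. For $0<p<\infty$, $A^p(\Omega)=\{f\in\mathcal O(\Omega):\|f\|_p^p:=\int_\Omega|f|^p<\infty\}$ and the $p$-Bergman kernel is $K_p(z):=\bigl(\inf\{\|f\|_p: f\in A^p(\Omega),\ f(z)=1\}\bigr)^{-p}$. *)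

(* Defs.v *)
From mathcomp Require Import all_boot all_order all_algebra.
From mathcomp Require Import all_classical all_reals all_analysis.
From mathcomp Require Export complex.
Set Implicit Arguments.
Unset Strict Implicit.
Unset Printing Implicit Defensive.
Import Order.TTheory GRing.Theory Num.Theory.
Import numFieldNormedType.Exports.

Local Open Scope classical_set_scope.
Local Open Scope ring_scope.
Local Open Scope complex_scope.

(* [R[i]] carries no topology of its own: the regular module [R[i]^o] is the
   copy of the complex field on which the library puts one, induced by the
   modulus. *)
Notation cplx R := (R[i]^o).

Section ComplexPlane.
Context {R : realType}.
Implicit Types (D : set (cplx R)) (f : cplx R -> cplx R) (z : cplx R) (p r : R).

Definition cplx_of_pair (xy : measurableTypeR R * measurableTypeR R) : cplx R :=
  xy.1 +i* xy.2.

Definition lebesgue2 :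
    {measure set (measurableTypeR R * measurableTypeR R) -> \bar R} :=
  (@lebesgue_measure R \x @lebesgue_measure R)%E.

Definition area D : \bar R := lebesgue2 (cplx_of_pair @^-1` D).

Definition domain D := [/\ D !=set0, open D & connected D].

Definition open_disc z r : set (cplx R) := ball z r%:C.

(* The library's [closed_ball] is the closure of the open ball, hence the
   explicit inequality on the modulus. *)
Definition closed_disc z r : set (cplx R) := [set w | `|z - w| <= r%:C].

(* The scalars of [R[i]^o] are complex, so [derivable f z 1] is the existence
   of the limit of [(f (z + h) - f z) / h] as the complex number [h] tends
   to 0. Functions on D are total functions whose values outside D are
   never used. *)
Definition holomorphic_on D f := forall z, D z -> derivable f z 1.

Definition Lp_norm D p f : \bar R :=
  ((\int[lebesgue2]_(xy in cplx_of_pair @^-1` D)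
      ((Normc.normc (f (cplx_of_pair xy)) `^ p)%R)%:E) `^ p^-1)%E.

Definition bergman_space D p : set (cplx R -> cplx R) :=
  [set f | holomorphic_on D f /\ (Lp_norm D p f < +oo)%E].

Definition bergman_kernel D p z : R :=
  inf [set fine (Lp_norm D p f) |
        f in [set f | bergman_space D p f /\ f z = 1]] `^ (- p).

End ComplexPlane.

(* Main.v *)
From HB Require Import structures.
Require Import Defs.
From mathcomp Require Import all_boot all_order all_algebra.
From mathcomp Require Import all_classical all_reals all_analysis.
From mathcomp Require Import measurable_realfun.
From mathcomp Require Import ring lra zify.

(** The proof is Kuran's characterisation of discs by the mean value property,
    run with test functions that belong to A^p.

    The hypothesis K_p(a) = 1/|Omega| says that the constant 1 minimises the
    integral of |f|^p over Omega among the f in A^p with f(a) = 1. Comparing 1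
    with 1 - t h, where h(a) = 0 and t > 0 is small, the first order term of
    |1 - t h|^p is - p t Re h, so the integral of Re h over Omega is at most 0
    ([integral_Re_le0_of_kernel]). The remainder is of order t^(3/2) as soon as
    |h| is integrable to the powers 3/2 and max(p, 3/2).

    Let B be the largest disc centred at a inside Omega in case (1), inside the
    closure of Omega in case (2), and let r be its radius. In both cases B is
    contained in Omega up to a null set. Take h(z) = (z - a)/(z - b), where b
    lies outside Omega, respectively outside its closure, and |b - a| is arbitrarily
    close to r. In case (1) the pole b may be a boundary point,
    but a simple pole is integrable to every power less than 2, which is where
    p < 2 is used; in case (2) the function h is bounded.

    If |b - a| = r, then the integral of Re h over B is zero, and Re h >= 1/2
    outside B. Therefore |Omega \ B| / 2 is at most the integral of Re h over
    Omega, hence at most 0 ([area_excess_le]). In general |b - a| is slightly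
    larger than r, and b is moved radially onto the circle; this changes the
    integrals by O(|b - c|^(1/2)) when b is moved to c
    ([integral_cauchy_quotient_pole]). In the limit Omega is contained
    in the closed disc ([sub_closed_disc_of_integral_le0]), and both conclusions
    follow.

    The mean value property over B is obtained without polar coordinates. Planar
    Lebesgue measure is invariant under shears, hence under the rotation by
    (3 + 4i)/5, none of whose positive powers is 1; so each monomial (z - a)^j
    with j >= 1 has integral zero over B ([integral_monomial]). A geometric
    series handles a pole outside the closed disc ([mean_value_pole_outside]),
    and continuity in the pole brings it to the circle ([mean_value_pole_boundary]). *)

Set Implicit Arguments.
Unset Strict Implicit.
Unset Printing Implicit Defensive.
Import Order.TTheory GRing.Theory Num.Theory.
Import numFieldNormedType.Exports.
Local Open Scope classical_set_scope.
Local Open Scope ring_scope.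
Local Open Scope complex_scope.

Local Notation Re := complex.Re.
Local Notation Im := complex.Im.
Local Notation normc := Normc.normc.
Local Notation plane R := (measurableTypeR R * measurableTypeR R)%type.
Local Notation pre D := (@cplx_of_pair _ @^-1` D).

(** * The modulus and the topology of the complex plane *)

Section ComplexModulus.
Context {R : realType}.
Implicit Types (z w : cplx R) (D : set (cplx R)).

Lemma normrE z : `|z| = (normc z)%:C.
Proof. by case: z. Qed.

Lemma normc_ge0 z : 0 <= normc z.
Proof. by case: z => x y; exact: sqrtr_ge0. Qed.

Lemma sqr_normcE z : normc z ^+ 2 = Re z ^+ 2 + Im z ^+ 2.
Proof. by case: z => x y /=; rewrite sqr_sqrtr // addr_ge0 ?sqr_ge0. Qed.

Lemma normr_Re_le z : `|Re z| <= normc z.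
Proof.
rewrite -(ler_pXn2r (n := 2)) ?nnegrE ?normc_ge0 // sqr_normcE real_normK ?num_real //.
by rewrite lerDl sqr_ge0.
Qed.

Lemma normr_Im_le z : `|Im z| <= normc z.
Proof.
rewrite -(ler_pXn2r (n := 2)) ?nnegrE ?normc_ge0 // sqr_normcE real_normK ?num_real //.
by rewrite lerDr sqr_ge0.
Qed.

Lemma normc_le_ReIm z : normc z <= `|Re z| + `|Im z|.
Proof.
rewrite -(ler_pXn2r (n := 2)) ?nnegrE ?normc_ge0 ?addr_ge0 // sqr_normcE sqrrD.
rewrite !real_normK ?num_real // addrAC lerDl mulrn_wge0 // mulr_ge0 //.
Qed.

Lemma normc_gt0 z : (0 < normc z) = (z != 0).
Proof.
rewrite lt_neqAle normc_ge0 andbT eq_sym; congr negb; apply/eqP/eqP.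
  exact: Normc.eq0_normc.
by move->; exact: Normc.normc0.
Qed.

Lemma normc_le_add z w : normc (z + w) <= normc z + normc w.
Proof. exact: le_normcD. Qed.

Lemma normcBC z w : normc (z - w) = normc (w - z).
Proof. by rewrite -opprB normcN. Qed.

Lemma normcX z n : normc (z ^+ n) = normc z ^+ n.
Proof.
elim: n => [|n IH]; first by rewrite !expr0 Normc.normc1.
by rewrite !exprS Normc.normcM IH.
Qed.

Lemma normc_real (x : R) : normc x%:C = `|x|.
Proof. by rewrite /= expr0n /= addr0 sqrtr_sqr. Qed.

Lemma open_discE z (r : R) w : open_disc z r w = (normc (z - w) < r).
Proof. by rewrite /open_disc -ball_normE /ball_ /= normrE ltcR. Qed.

Lemma closed_discE z (r : R) w : closed_disc z r w = (normc (z - w) <= r).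
Proof. by rewrite /closed_disc /= normrE lecR. Qed.

Lemma gt0_real_complex (e : R[i]) : 0 < e -> exists2 r : R, 0 < r & e = r%:C.
Proof.
case: e => x y; rewrite ltcE /= => /andP[/eqP -> x0]; by exists x.
Qed.

Lemma nbhs_discP z D :
  nbhs z D <-> exists2 r : R, 0 < r & open_disc z r `<=` D.
Proof.
split=> [/nbhs_ballP[e /= e0 eD]|[r r0 rD]].
  have [r r0 er] := gt0_real_complex e0.
  by exists r => //; rewrite /open_disc -er.
by apply/nbhs_ballP; exists r%:C => //=; rewrite ltcR.
Qed.

Lemma openP_disc D :
  open D <-> forall z, D z -> exists2 r : R, 0 < r & open_disc z r `<=` D.
Proof.
rewrite openE; split=> [oD z /oD|oD z /oD].
  by move/nbhs_discP.
by move=> h; apply/nbhs_discP.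
Qed.

Lemma open_open_disc z (r : R) : open (open_disc z r).
Proof.
apply/openP_disc => w; rewrite open_discE => wr.
exists (r - normc (z - w)); first by rewrite subr_gt0.
move=> v; rewrite !open_discE ltrBrDl; apply: le_lt_trans.
have -> : z - v = (z - w) + (w - v) by ring.
exact: normc_le_add.
Qed.

Lemma bounded_normc D : bounded_set D ->
  exists2 M : R, 0 < M & forall z, D z -> normc z <= M.
Proof.
move=> [M [Mr MD]].
have [m [m0 Mm]] : exists m : R, 0 < m /\ M < m%:C.
  move/complex_realP : Mr => [k ->]; exists (`|k| + 1).
  by rewrite ltcR ltr_wpDl // (le_lt_trans (ler_norm _)) // ltrDl.
exists m => // z Dz; have := MD _ Mm z Dz.
by rewrite /= normrE lecR.
Qed.

End ComplexModulus.

(** * Planar Lebesgue measure of open sets *)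

Section PlanarMeasure.
Context {R : realType}.
Implicit Types (z w : cplx R) (D : set (cplx R)) (r : R).

(** Squares with sides parallel to the axes are products of intervals, so that
    their area is explicit. *)
Definition open_square z r : set (cplx R) :=
  [set w | `|Re z - Re w| < r /\ `|Im z - Im w| < r].

Lemma sub_open_disc_square z r : open_disc z r `<=` open_square z r.
Proof.
move=> w; rewrite open_discE => zw; split; apply: le_lt_trans zw.
- by move: (normr_Re_le (z - w)); case: z w => [? ?] [].
- by move: (normr_Im_le (z - w)); case: z w => [? ?] [].
Qed.

Lemma sub_open_square_disc z r : open_square z r `<=` open_disc z (2 * r).
Proof.
move=> w [h1 h2]; rewrite open_discE; apply: le_lt_trans (normc_le_ReIm _) _.
by rewrite mulrDl mul1r; move: h1 h2; case: z w => [? ?] [? ?]; exact: ltrD.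
Qed.

Lemma preimage_open_square z r : pre (open_square z r) =
  `](Re z - r), (Re z + r)[ `*` `](Im z - r), (Im z + r)[.
Proof.
apply/seteqP; split=> -[x y] /=; rewrite /open_square /cplx_of_pair /= !in_itv /=.
- by rewrite !ltr_norml => -[/andP[? ?] /andP[? ?]]; split; apply/andP; split; lra.
- by rewrite !ltr_norml => -[/andP[? ?] /andP[? ?]]; split; apply/andP; split; lra.
Qed.

Lemma measurable_open_square z r : measurable (pre (open_square z r)).
Proof. by rewrite preimage_open_square; apply: measurableX; exact: measurable_itv. Qed.

Let length_itv (a r : R) : 0 < r ->
  @lebesgue_measure R `](a - r), (a + r)[ = (2 * r)%:E.
Proof.
move=> r0; rewrite lebesgue_measure_itv /= lte_fin ifT; last by lra.
by rewrite -EFinB; congr (_%:E); ring.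
Qed.

Lemma area_open_square z r : 0 < r -> area (open_square z r) = (4 * r ^+ 2)%:E.
Proof.
move=> r0; rewrite /area preimage_open_square /lebesgue2.
rewrite [LHS]product_measure1E; try exact: measurable_itv.
transitivity ((2 * r)%:E * (2 * r)%:E)%E.
  by congr (_ * _)%E; exact: length_itv.
by rewrite -EFinM; congr (_%:E); ring.
Qed.

(** An open set is the union of the squares with rational centre and radius
    1/(n+1) that it contains. *)
Lemma measurable_open D : open D -> measurable (pre D).
Proof.
move=> /openP_disc oD.
pose F (q : rat * rat * nat) : set (plane R) :=
  let S := open_square (ratr q.1.1 +i* ratr q.1.2) q.2.+1%:R^-1 in
  [set u | S `<=` D /\ pre S u].
have -> : pre D = \bigcup_q F q.
  apply/seteqP; split=> [[x y] Dxy|u [q _] [SD]]; last exact: SD.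
  have [r r0 rD] := oD _ Dxy.
  have [n [e [e0 ee er]]] :
      exists n e, [/\ 0 < e, e = n.+1%:R^-1 :> R & e < r / 4].
    have /cvgrPdist_lt/(_ (r / 4))[|n _ /(_ n)] := @cvg_harmonic R; first lra.
    rewrite /= sub0r normrN ger0_norm ?invr_ge0 ?ler0n // => h.
    by exists n, n.+1%:R^-1; split; rewrite ?invr_gt0 ?ltr0Sn ?h.
  have xn : x - e < x + e by lra.
  have yn : y - e < y + e by lra.
  have [q1] := rat_in_itvoo xn; rewrite in_itv /= => /andP[q1l q1r].
  have [q2] := rat_in_itvoo yn; rewrite in_itv /= => /andP[q2l q2r].
  exists (q1, q2, n) => //; rewrite /F /= -ee; split => /=.
  - move=> [u v] [/=]; rewrite !ltr_norml => /andP[? ?] /andP[? ?].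
    apply: rD; rewrite open_discE; apply: le_lt_trans (normc_le_ReIm _) _.
    have -> : r = r / 2 + r / 2 by lra.
    by apply: ltrD; rewrite /= ltr_norml; apply/andP; split; lra.
  - by split; rewrite /= ltr_norml; apply/andP; split; lra.
apply: countable_bigcupT_measurable => [|q]; first exact: countableP.
rewrite /F; set S := open_square _ _.
have [SD|nSD] := pselect (S `<=` D).
  rewrite (_ : [set u | _] = pre S); first exact: measurable_open_square.
  by apply/seteqP; split=> u //= [].
rewrite (_ : [set u | _] = set0) //.
by apply/seteqP; split=> u //= [].
Qed.

Lemma le_area D D' : measurable (pre D) -> measurable (pre D') ->
  D `<=` D' -> (area D <= area D')%E.
Proof.
move=> mD mD' DD'; rewrite /area le_measure ?inE //.
by move=> u; exact: DD'.
Qed.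

Lemma area_gt0 D : open D -> D !=set0 -> (0 < area D)%E.
Proof.
move=> oD [z Dz]; have [r r0 rD] := iffLR (openP_disc D) oD _ Dz.
have sD : open_square z (r / 2) `<=` D.
  by move=> w /sub_open_square_disc h; apply: rD; rewrite (_ : r = 2 * (r / 2)) //; field.
apply: lt_le_trans (le_area _ _ sD); last exact: measurable_open.
- by rewrite area_open_square ?divr_gt0 // lte_fin mulr_gt0 // exprn_gt0 // divr_gt0.
- exact: measurable_open_square.
Qed.

Lemma area_fin D z r : open D -> 0 < r -> D `<=` open_square z r ->
  (area D < +oo)%E.
Proof.
move=> oD r0 DS; apply: le_lt_trans (le_area _ _ DS) _; try exact: measurable_open.
  exact: measurable_open_square.
by rewrite area_open_square // ltry.
Qed.

End PlanarMeasure.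

(** * Measurability of complex-valued functions *)

Section ComplexMeasurable.
Context {R : realType}.
Implicit Types (f g : plane R -> cplx R).

Definition cmeasurable f :=
  measurable_fun setT (fun u => Re (f u)) /\
  measurable_fun setT (fun u => Im (f u)).

Lemma cmeasurable_cst (c : cplx R) : cmeasurable (fun=> c).
Proof. by split; exact: measurable_cst. Qed.

Lemma cmeasurable_id : cmeasurable (@cplx_of_pair R).
Proof. by split; [exact: measurable_fst|exact: measurable_snd]. Qed.

Lemma cmeasurableD f g : cmeasurable f -> cmeasurable g ->
  cmeasurable (fun u => f u + g u).
Proof.
move=> [f1 f2] [g1 g2]; split.
- rewrite (_ : (fun u => _) = (fun u => Re (f u)) \+ (fun u => Re (g u))).
    exact: measurable_funD.
  by apply/funext => u /=; case: (f u) (g u) => [? ?] [].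
- rewrite (_ : (fun u => _) = (fun u => Im (f u)) \+ (fun u => Im (g u))).
    exact: measurable_funD.
  by apply/funext => u /=; case: (f u) (g u) => [? ?] [].
Qed.

Lemma cmeasurableM f g : cmeasurable f -> cmeasurable g ->
  cmeasurable (fun u => f u * g u).
Proof.
move=> [f1 f2] [g1 g2]; split.
- rewrite (_ : (fun u => _) = (fun u => Re (f u) * Re (g u) - Im (f u) * Im (g u))).
    by apply: measurable_funB; exact: measurable_funM.
  by apply/funext => u /=; case: (f u) (g u) => [? ?] [].
- rewrite (_ : (fun u => _) = (fun u => Re (f u) * Im (g u) + Im (f u) * Re (g u))).
    by apply: measurable_funD; exact: measurable_funM.
  by apply/funext => u /=; case: (f u) (g u) => [? ?] [].
Qed.

Lemma cmeasurableB f g : cmeasurable f -> cmeasurable g ->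
  cmeasurable (fun u => f u - g u).
Proof.
move=> mf mg; rewrite (_ : (fun u => _) = (fun u => f u + (-1) * g u)).
  by apply: cmeasurableD => //; apply: cmeasurableM => //; exact: cmeasurable_cst.
by apply/funext => u; rewrite mulN1r.
Qed.

Lemma cmeasurableX f n : cmeasurable f -> cmeasurable (fun u => f u ^+ n).
Proof.
move=> mf; elim: n => [|n IH]; first exact: cmeasurable_cst.
rewrite (_ : (fun u => _) = (fun u => f u * f u ^+ n)); first exact: cmeasurableM.
by apply/funext => u; rewrite exprS.
Qed.

Lemma cmeasurableV f : cmeasurable f -> cmeasurable (fun u => (f u)^-1).
Proof.
move=> [f1 f2].
have m : measurable_fun setT (fun u => (Re (f u) ^+ 2 + Im (f u) ^+ 2)^-1).
  rewrite (_ : (fun u => _) = (@powR R)^~ (-1) \o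
      (fun u => Re (f u) ^+ 2 + Im (f u) ^+ 2)).
    apply: measurableT_comp; first exact: measurable_powR.
    by apply: measurable_funD; exact: measurable_funX.
  by apply/funext => u /=; rewrite powR_inv1 // addr_ge0 ?sqr_ge0.
split.
- rewrite (_ : (fun u => _) = (fun u => Re (f u) * (Re (f u) ^+ 2 + Im (f u) ^+ 2)^-1)).
    exact: measurable_funM.
  by apply/funext => u; case: (f u) => x y.
- rewrite (_ : (fun u => _) = (fun u => - (Im (f u) * (Re (f u) ^+ 2 + Im (f u) ^+ 2)^-1))).
    by apply: measurable_funN; exact: measurable_funM.
  by apply/funext => u; case: (f u) => x y.
Qed.

Lemma measurable_normc f : cmeasurable f -> measurable_fun setT (fun u => normc (f u)).
Proof.
move=> [f1 f2].
rewrite (_ : (fun u => _) = (@powR R)^~ 2^-1 \o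
    (fun u => Re (f u) ^+ 2 + Im (f u) ^+ 2)).
  apply: measurableT_comp; first exact: measurable_powR.
  by apply: measurable_funD; exact: measurable_funX.
by apply/funext => u /=; rewrite powR12_sqrt ?addr_ge0 ?sqr_ge0 //; case: (f u).
Qed.

Lemma measurable_normc_powR f (p : R) : cmeasurable f ->
  measurable_fun setT (fun u => normc (f u) `^ p).
Proof.
move=> mf; apply: (@measurableT_comp _ _ _ _ _ _ ((@powR R)^~ p)).
  exact: measurable_powR.
exact: measurable_normc.
Qed.

End ComplexMeasurable.

(** * Integrals of negative powers of the modulus *)

Section SingularIntegral.
Context {R : realType}.

(** The squares of radii L/2^n around c cover the punctured square dyadically;
    on the n-th layer the integrand is at most (L/2^(n+1))^(-q), and the layers
    contribute a geometric series of ratio 2^(q-2). *)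
Lemma integral_modulus_powN (q L : R) : 0 < q < 2 -> 0 < L ->
  exists C : R, forall c : cplx R,
    (\int[lebesgue2]_(u in pre (open_square c L))
       (normc (cplx_of_pair u - c) `^ (- q))%:E <= C%:E)%E.
Proof.
move=> /andP[q0 q2] L0.
pose t : R := 2^-1 `^ (- q).
have t4 : t < 4.
  have -> : 4 = 2^-1 `^ (- 2%:R) :> R.
    by rewrite powR_invn ?invr_ge0 // -exprVn invrK; ring.
  rewrite /t !powRN ltf_pV2 ?posrE ?powR_gt0 //.
  rewrite /powR gt_eqF // ?invr_gt0 // ltr_expR.
  by rewrite ltr_nM2r ?lnV ?posrE // ?oppr_lt0 ?ln_gt0 //; lra.
have t0 : 0 < t by exact: powR_gt0.
pose rad n : R := L * 2^-1 ^+ n.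
have rad0 n : 0 < rad n by rewrite mulr_gt0 // exprn_gt0 // invr_gt0.
pose a n : R := rad n.+1 `^ (- q).
pose b : R := 4 * L ^+ 2 * (L `^ (- q)) * t.
have ab n : a n * (4 * rad n ^+ 2) = b * (t / 4) ^+ n.
  rewrite /a /rad powRM ?(ltW L0) // ?exprn_ge0 ?invr_ge0 //.
  have -> : (2^-1 ^+ n.+1 : R) `^ (- q) = t ^+ n.+1.
    by rewrite -(@powR_mulrn _ 2^-1) ?invr_ge0 // powRAC powR_mulrn ?powR_ge0.
  rewrite exprS /b exprMn exprMn -!exprM mulnC exprM.
  have -> : (2^-1 ^+ 2 : R) = 4^-1 by field.
  by ring.
exists (b / (1 - t / 4)) => c.
pose F n (u : plane R) : \bar R := (a n * \1_(pre (open_square c (rad n))) u)%:E.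
have mS r : measurable (pre (open_square c r)) by exact: measurable_open_square.
have a0 n : 0 <= a n by exact: powR_ge0.
have F0 n u : (0 <= F n u)%E by rewrite lee_fin mulr_ge0.
have mF n D : measurable_fun D (F n).
  apply/measurable_EFinP; apply: measurable_funM; first exact: measurable_cst.
  by apply: measurable_indic.
have mf D : measurable_fun D (fun u => (normc (cplx_of_pair u - c) `^ (- q))%:E).
  apply/measurable_EFinP/measurable_funTS; apply: measurable_normc_powR.
  by apply: cmeasurableB; [exact: cmeasurable_id|exact: cmeasurable_cst].
apply: (@le_trans _ _ (\int[lebesgue2]_(u in pre (open_square c L))
    (\sum_(0 <= n <oo) F n u))%E).
  apply: ge0_le_integral => //.
  - by move=> u _; rewrite lee_fin powR_ge0.
  - exact: ge0_emeasurable_sum.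
  move=> u uL.
  have [->|uc] := eqVneq (cplx_of_pair u) c.
    rewrite subrr Normc.normc0 powR0 ?oppr_eq0 ?gt_eqF //.
    exact: nneseries_ge0.
  have rad_lt (e : R) : 0 < e -> exists n, rad n < e.
    move=> e0.
    have : (rad n @[n --> \oo] --> 0)%classic.
      by apply: cvg_geometric; rewrite ger0_norm ?invr_ge0 // invf_lt1 // ltr1n.
    move=> /cvgrPdist_lt/(_ _ e0)[n _ /(_ n)] h; exists n.
    by have := h (leqnn _); rewrite sub0r normrN ger0_norm // ltW.
  have exn : exists n, `[< ~ open_square c (rad n) (cplx_of_pair u) >].
    have d0 : 0 < normc (c - cplx_of_pair u) by rewrite normc_gt0 subr_eq0 eq_sym.
    have [|n nr] := rad_lt (normc (c - cplx_of_pair u) / 2); first exact: divr_gt0.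
    exists n; apply/asboolP => /sub_open_square_disc; rewrite open_discE; lra.
  pose m := ex_minn exn.
  have [m0 mS' mmin] : [/\ (0 < m)%N, ~ open_square c (rad m) (cplx_of_pair u) &
      open_square c (rad m.-1) (cplx_of_pair u)].
    rewrite /m; case: ex_minnP => k /asboolP hk kmin.
    have k0 : (0 < k)%N.
      rewrite lt0n; apply/eqP => k0; apply: hk; rewrite k0 /rad expr0 mulr1.
      exact: uL.
    split => //; apply/not_notP => /asboolP/kmin; by rewrite -ltnS prednK // ltnn.
  apply: (@le_trans _ _ (F m.-1 u)); last first.
    have := @nneseries_lim_ge R (fun n => F n u) xpredT 0 m (fun n _ _ => F0 n u).
    apply: le_trans; rewrite -(prednK m0) big_nat_recr //=.
    by rewrite leeDr // sume_ge0.
  rewrite /F indicE mem_set // mulr1 lee_fin /a prednK //.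
  rewrite !powRN lef_pV2 ?posrE ?powR_gt0 ?normc_gt0 ?subr_eq0 //.
  have le : rad m <= normc (cplx_of_pair u - c).
    rewrite normcBC leNgt; apply/negP => h.
    by apply: mS'; apply: sub_open_disc_square; rewrite open_discE.
  by apply: ge0_ler_powR; rewrite ?nnegrE ?normc_ge0 ?(ltW q0) ?(ltW (rad0 _)).
have intF n : (\int[lebesgue2]_(u in pre (open_square c L)) F n u <=
    (b * (t / 4) ^+ n)%:E)%E.
  rewrite -ab EFinM -(area_open_square c (rad0 n)) /F.
  under eq_integral do rewrite EFinM.
  rewrite ge0_integralZl_EFin //; last 1 first.
  - by apply/measurable_EFinP; exact: measurable_indic.
  apply: lee_wpmul2l; first by rewrite lee_fin.
  by rewrite integral_indic // le_measure ?inE //; exact: measurableI.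
have tt : 0 < 1 - t / 4 by lra.
have t41 : 0 <= t / 4 by lra.
rewrite integral_nneseries //; apply: lime_le.
  by apply: is_cvg_nneseries => n _ _; exact: integral_ge0.
near=> N; apply: (@le_trans _ _ (\sum_(0 <= n < N) (b * (t / 4) ^+ n)%:E)%E).
  by apply: lee_sum => n _; exact: intF.
rewrite sumEFin lee_fin.
have /(congr1 (fun f => f N)) /= := geometric_seriesE b (ltac:(lra) : t / 4 != 1).
rewrite /series /= => ->.
rewrite ler_pM2r ?invr_gt0 // ger_pMr ?gerBl ?exprn_ge0 //.
by rewrite mulr_gt0 // mulr_gt0 ?powR_gt0 // mulr_gt0 // exprn_gt0.
Unshelve. all: by end_near. Qed.

End SingularIntegral.

(** * Area-preserving maps and rotations *)

Section MeasurePreserving.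
Context {R : realType}.

(** Translation preserves the lengths of intervals, which determine the
    measure. *)
Lemma lebesgue_measure_translation (c : R) (A : set (measurableTypeR R)) :
  measurable A ->
  lebesgue_measure ((fun x => x + c) @^-1` A) = @lebesgue_measure R A.
Proof.
move=> mA.
have mT : measurable_fun setT (fun x : measurableTypeR R => x + c : measurableTypeR R).
  by apply: measurable_funD; [exact: measurable_id|exact: measurable_cst].
pose T : {mfun measurableTypeR R >-> measurableTypeR R} :=
  HB.pack (fun x : measurableTypeR R => x + c : measurableTypeR R)
    (isMeasurableFun.Build _ _ _ _ _ mT).
rewrite [RHS](lebesgue_measure_unique (mu := pushforward lebesgue_measure T)) //.
move=> _ [[a b] _ <-] /=; rewrite /pushforward.
have -> : (fun x : R => x + c) @^-1` `]a, b]%classic = `](a - c), (b - c)]%classic.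
  by apply/seteqP; split=> x; rewrite /= !in_itv /= => /andP[? ?]; apply/andP; split; lra.
rewrite !lebesgue_measure_itv /= !lte_fin ltrD2r.
by case: ifP => // _; rewrite -!EFinB; congr (_%:E); ring.
Qed.

Definition area_preserving (T : plane R -> plane R) :=
  measurable_fun setT T /\
  forall A, measurable A -> lebesgue2 (T @^-1` A) = lebesgue2 A.

Lemma area_preserving_comp S T : area_preserving S -> area_preserving T ->
  area_preserving (S \o T).
Proof.
move=> [mS pS] [mT pT]; split; first exact: measurableT_comp.
move=> A mA; rewrite comp_preimage pT ?pS //.
by rewrite -[_ @^-1` _]setTI; exact: mS.
Qed.

Variable phi : measurableTypeR R -> measurableTypeR R.
Hypothesis mphi : measurable_fun setT phi.

(** On each vertical line the map is a translation, so Fubini applies. *)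
Lemma area_preserving_vertical_shear :
  area_preserving (fun u => (u.1, u.2 + phi u.1)).
Proof.
have mT : measurable_fun setT (fun u : plane R => (u.1, u.2 + phi u.1) : plane R).
  apply: measurable_fun_pair; first exact: measurable_fst.
  apply: measurable_funD; first exact: measurable_snd.
  by apply: measurableT_comp => //; exact: measurable_fst.
split=> // A mA; rewrite /lebesgue2 /= /product_measure1.
apply: eq_integral => x _ /=.
rewrite -[RHS](lebesgue_measure_translation (phi x)); last exact: measurable_xsection.
by congr lebesgue_measure; apply/seteqP; split=> y /=; rewrite /xsection /= !inE.
Qed.

(** Slicing a planar set along either axis gives the same measure. *)
Lemma lebesgue2_ysection (A : set (plane R)) : measurable A ->
  lebesgue2 A = (\int[lebesgue_measure]_y lebesgue_measure (ysection A y))%E.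
Proof.
move=> mA; rewrite /lebesgue2.
have h := @product_measure_unique _ _ _ _ R (@lebesgue_measure R)
  (@lebesgue_measure R) (product_measure2 (@lebesgue_measure R) (@lebesgue_measure R)).
by apply: h => // B C mB mC; exact: product_measure2E.
Qed.

Lemma area_preserving_horizontal_shear :
  area_preserving (fun u => (u.1 + phi u.2, u.2)).
Proof.
have mT : measurable_fun setT (fun u : plane R => (u.1 + phi u.2, u.2) : plane R).
  apply: measurable_fun_pair; last exact: measurable_snd.
  apply: measurable_funD; first exact: measurable_fst.
  by apply: measurableT_comp => //; exact: measurable_snd.
split=> // A mA; rewrite !lebesgue2_ysection //; last first.
  by rewrite -[_ @^-1` _]setTI; exact: mT.
apply: eq_integral => y _ /=.
rewrite -[RHS](lebesgue_measure_translation (phi y)); last exact: measurable_ysection.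
by congr lebesgue_measure; apply/seteqP; split=> x /=; rewrite /ysection /= !inE.
Qed.

End MeasurePreserving.

Section Rotation.
Context {R : realType}.
Implicit Types (a z : cplx R).

(** A rotation of infinite order whose half-angle has a rational tangent, so
    that it factors through rational shears. *)
Definition rot35 : cplx R := (3 / 5) +i* (4 / 5).

Lemma normc_rot35 : normc rot35 = 1.
Proof.
have E : (3 / 5) ^+ 2 + (4 / 5) ^+ 2 = 1 :> R by field.
by rewrite /= E sqrtr1.
Qed.

(** Modulo 5 every power of 3 + 4i is 3 + 4i, so none is 5^j. *)
Lemma rot35_powN1 j : rot35 ^+ j.+1 != 1.
Proof.
have [m [n E]] : exists m n : int,
    5%:R ^+ j.+1 * rot35 ^+ j.+1 = (5 * m + 3)%:~R +i* (5 * n + 4)%:~R.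
  elim: j => [|j [m [n IH]]].
    exists 0, 0; rewrite !expr1 /rot35; apply/eqP; rewrite eq_complex /=.
    by apply/andP; split; apply/eqP; field.
  exists (3 * m - 4 * n - 2), (4 * m + 3 * n + 4).
  rewrite exprS [rot35 ^+ _]exprS mulrACA IH /rot35.
  apply/eqP; rewrite eq_complex /=; apply/andP.
  by split; apply/eqP; rewrite !(rmorphD, rmorphM, rmorphN) /=; field.
apply/eqP => E1; move: E; rewrite E1 mulr1.
have -> : 5%:R ^+ j.+1 = (5%:R ^+ j.+1)%:C :> R[i] by rewrite rmorphXn rmorph_nat.
move=> /(congr1 (fun z => Im z)) /= /esym/eqP.
by rewrite intr_eq0 => /eqP; lia.
Qed.

(** A rotation by theta is a product of three shears, with coefficients
    - tan(theta/2), sin(theta), - tan(theta/2); here tan(theta/2) = 1/2. *)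
Lemma area_preserving_rot35 a : exists2 T : plane R -> plane R,
  area_preserving T &
  forall u, cplx_of_pair (T u) = a + rot35 * (cplx_of_pair u - a) :> cplx R.
Proof.
pose S1 (u : plane R) : plane R := (u.1 + (- (2^-1) * (u.2 - Im a)), u.2).
pose S2 (u : plane R) : plane R := (u.1, u.2 + 4 / 5 * (u.1 - Re a)).
have mlin (k c : R) : measurable_fun setT
    (fun x : measurableTypeR R => k * (x - c) : measurableTypeR R).
  apply: measurable_funM; first exact: measurable_cst.
  by apply: measurable_funB; [exact: measurable_id|exact: measurable_cst].
have p1 : area_preserving S1 by exact: (area_preserving_horizontal_shear (mlin _ _)).
have p2 : area_preserving S2 by exact: (area_preserving_vertical_shear (mlin _ _)).
exists (S1 \o S2 \o S1).
  by apply: area_preserving_comp => //; exact: area_preserving_comp.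
move=> [x y]; rewrite /S1 /S2 /rot35 /cplx_of_pair /= {S1 S2 p1 p2}.
case: a => a1 a2; apply/eqP; rewrite eq_complex /=.
by apply/andP; split; apply/eqP; field.
Qed.

Lemma integral_disc_rot35 a (r : R) (F : cplx R -> R) :
  measurable_fun setT (F \o @cplx_of_pair R) ->
  lebesgue2.-integrable (pre (open_disc a r))
    (fun u => (F (a + rot35 * (cplx_of_pair u - a)))%:E) ->
  \int[lebesgue2]_(u in pre (open_disc a r)) F (cplx_of_pair u) =
  \int[lebesgue2]_(u in pre (open_disc a r))
    F (a + rot35 * (cplx_of_pair u - a)).
Proof.
move=> mF iF; have [T [mT pT] TE] := area_preserving_rot35 a.
have preT : T @^-1` (pre (open_disc a r)) = pre (open_disc a r).
  have H u : normc (a - (a + rot35 * (cplx_of_pair u - a))) =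
      normc (a - cplx_of_pair u).
    by rewrite opprD addNKr normcN Normc.normcM normc_rot35 mul1r normcBC.
  by apply/seteqP; split=> u /=; rewrite TE !open_discE H.
have mD : measurable (pre (open_disc a r)) by apply: measurable_open; exact: open_open_disc.
congr fine.
transitivity (\int[pushforward lebesgue2 T]_(u in pre (open_disc a r))
    (F (cplx_of_pair u))%:E)%E.
  pose T' : {mfun plane R >-> plane R} :=
    HB.pack T (isMeasurableFun.Build _ _ _ _ _ mT).
  rewrite -[pushforward lebesgue2 T]/(pushforward lebesgue2 T').
  by apply: eq_measure_integral => A mA _; exact/esym/pT.
rewrite integral_pushforward //.
- by rewrite preT; apply: eq_integral => u _ /=; rewrite TE.
- exact/measurable_EFinP.
- by rewrite preT; apply: eq_integrable iF => // u _ /=; rewrite TE.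
Qed.

End Rotation.

(** * Integrability criteria *)

Section PlanarIntegrability.
Context {R : realType}.
Implicit Types (D : set (plane R)) (f : plane R -> R) (h : plane R -> cplx R).

Lemma integrable_constant D (k : R) : measurable D -> (lebesgue2 D < +oo)%E ->
  lebesgue2.-integrable D (fun=> k%:E).
Proof.
move=> mD fD; apply/integrableP; split; first exact: measurable_cst.
by rewrite integral_cst // lte_mul_pinfty.
Qed.

Lemma integrable_bounded D f (M : R) : measurable D -> (lebesgue2 D < +oo)%E ->
  measurable_fun setT f -> (forall u, D u -> `|f u| <= M) ->
  lebesgue2.-integrable D (EFin \o f).
Proof.
move=> mD fD mf fM; apply: (le_integrable mD (g := EFin \o cst M)) => //.
- exact/measurable_EFinP/measurable_funTS.
- by move=> u /fM h; rewrite /= lee_fin (le_trans h) // ler_norm.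
- exact: integrable_constant.
Qed.

Lemma integrable_le D f g : measurable D -> measurable_fun setT f ->
  lebesgue2.-integrable D (EFin \o g) -> (forall u, D u -> `|f u| <= g u) ->
  lebesgue2.-integrable D (EFin \o f).
Proof.
move=> mD mf ig fg; apply: (le_integrable mD (g := EFin \o g)) => //.
- exact/measurable_EFinP/measurable_funTS.
- by move=> u /fg h; rewrite /= lee_fin (le_trans h) // ler_norm.
Qed.

Lemma integrable_add D f g : measurable D ->
  lebesgue2.-integrable D (fun u => (f u)%:E) ->
  lebesgue2.-integrable D (fun u => (g u)%:E) ->
  lebesgue2.-integrable D (fun u => (f u + g u)%:E).
Proof. by move=> mD i1 i2; exact: (integrableD mD i1 i2). Qed.

Lemma integrable_scale D (k : R) f : measurable D ->
  lebesgue2.-integrable D (fun u => (f u)%:E) ->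
  lebesgue2.-integrable D (fun u => (k * f u)%:E).
Proof. by move=> mD i1; exact: (integrableZl mD k i1). Qed.

Lemma ler_1DpowR (x q : R) : 0 <= x -> 1 <= q -> x <= 1 + x `^ q.
Proof.
move=> x0 q1; have [x1|/ltW x1] := leP x 1.
  by rewrite (le_trans x1) // lerDl powR_ge0.
by rewrite (le_trans (le1r_powR x1 q1)) // lerDr.
Qed.

(** On a set of finite area, integrability of a power q >= 1 of the modulus
    gives integrability, since x <= 1 + x^q. *)
Lemma integrable_Re_powR D h (q : R) : 1 <= q -> measurable D ->
  (lebesgue2 D < +oo)%E -> cmeasurable h ->
  lebesgue2.-integrable D (fun u => (normc (h u) `^ q)%:E) ->
  lebesgue2.-integrable D (fun u => (Re (h u))%:E).
Proof.
move=> q1 mD fD [mh mh'] iq.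
apply: (integrable_le (g := fun u => 1 + normc (h u) `^ q)) => //.
  by apply: integrable_add => //; exact: integrable_constant.
move=> u _; apply: le_trans (normr_Re_le _) _.
by apply: ler_1DpowR => //; exact: normc_ge0.
Qed.

End PlanarIntegrability.

(** * The quotient (z - a)/(z - b) *)

Section CauchyKernel.
Context {R : realType}.
Implicit Types (a b z : cplx R) (D : set (cplx R)).

(** Up to the factor 2, its real part is the Kuran harmonic function
    1 + (|z - a|^2 - |b - a|^2)/|z - b|^2. As division by zero gives zero, the
    quotient is 0 at its pole. *)
Definition cauchy_quotient a b z : cplx R := (z - a) / (z - b).

Lemma cmeasurable_cauchy_quotient a b :
  cmeasurable (fun u => cauchy_quotient a b (cplx_of_pair u)).
Proof.
apply: cmeasurableM; last apply: cmeasurableV.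
all: by apply: cmeasurableB; [exact: cmeasurable_id|exact: cmeasurable_cst].
Qed.

Lemma normc_cauchy_quotient a b z :
  normc (cauchy_quotient a b z) = normc (z - a) / normc (z - b).
Proof. by rewrite Normc.normcM Normc.normcV. Qed.

(** A pole is q-integrable for q < 2, even when it lies on the boundary or
    inside of the set. *)
Lemma integrable_cauchy_quotient_powR a b (L q : R) D : 0 < L -> 0 < q < 2 ->
  measurable (pre D) -> D `<=` open_square b L ->
  (forall z, D z -> normc (z - a) <= L) ->
  lebesgue2.-integrable (pre D)
    (fun u => (normc (cauchy_quotient a b (cplx_of_pair u)) `^ q)%:E).
Proof.
move=> L0 q02 mD Db Da; have [q0 _] := andP q02.
have mf c : measurable_fun setT (fun u => normc (cplx_of_pair u - c) `^ (- q)).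
  apply: measurable_normc_powR.
  by apply: cmeasurableB; [exact: cmeasurable_id|exact: cmeasurable_cst].
have [C HC] := integral_modulus_powN q02 L0.
have iS : lebesgue2.-integrable (pre D)
    (fun u => (normc (cplx_of_pair u - b) `^ (- q))%:E).
  apply: (integrableS (measurable_open_square b L)) => //.
    by move=> u; exact: Db.
  apply/integrableP; split; first by apply/measurable_EFinP/measurable_funTS; exact: mf.
  under eq_integral do rewrite gee0_abs ?lee_fin ?powR_ge0 //.
  exact: le_lt_trans (HC b) (ltry _).
apply: (integrable_le (g := fun u => L `^ q * normc (cplx_of_pair u - b) `^ (- q))) => //.
- by apply: measurable_normc_powR; exact: cmeasurable_cauchy_quotient.
- exact: integrable_scale.
- move=> u Du; rewrite ger0_norm ?powR_ge0 // normc_cauchy_quotient.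
  rewrite powRM ?invr_ge0 ?normc_ge0 // -powR_inv1 ?normc_ge0 // -powRrM mulN1r.
  rewrite ler_wpM2r ?powR_ge0 //.
  by apply: ge0_ler_powR; rewrite ?nnegrE ?normc_ge0 ?(ltW q0) ?(ltW L0) //; exact: Da.
Qed.

End CauchyKernel.

(** * The mean value property on a disc *)

Section MeanValue.
Context {R : realType}.
Implicit Types (a b c z : cplx R).
Variables (a : cplx R) (r : R).
Hypothesis r0 : 0 < r.
Let B := pre (open_disc a r).

Lemma measurable_disc : measurable B.
Proof. by apply: measurable_open; exact: open_open_disc. Qed.

Lemma area_disc_fin : (lebesgue2 B < +oo)%E.
Proof. exact: (area_fin (@open_open_disc _ a r) r0 (@sub_open_disc_square _ a r)). Qed.

Lemma discE u : B u -> normc (cplx_of_pair u - a) < r.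
Proof. by rewrite /B /preimage /= open_discE normcBC. Qed.

Lemma measurable_Re_mul_powX (k : cplx R) j :
  measurable_fun setT (fun u => Re (k * (cplx_of_pair u - a) ^+ j)).
Proof.
suff [] : cmeasurable (fun u => k * (cplx_of_pair u - a) ^+ j) by [].
apply: cmeasurableM; first exact: cmeasurable_cst.
by apply: cmeasurableX; apply: cmeasurableB; [exact: cmeasurable_id|exact: cmeasurable_cst].
Qed.

Lemma integrable_monomial (k : cplx R) j :
  lebesgue2.-integrable B (fun u => (Re (k * (cplx_of_pair u - a) ^+ j))%:E).
Proof.
apply: (integrable_bounded (M := normc k * r ^+ j)).
- exact: measurable_disc.
- exact: area_disc_fin.
- exact: measurable_Re_mul_powX.
move=> u /discE/ltW h; apply: le_trans (normr_Re_le _) _.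
rewrite Normc.normcM normcX ler_wpM2l ?normc_ge0 //.
by rewrite lerXn2r ?nnegrE ?normc_ge0 // ltW.
Qed.

(** The integral is unchanged when (z - a)^(j+1) is multiplied by the power of
    the rotation, which is not 1. *)
Lemma integral_monomial (k : cplx R) j :
  \int[lebesgue2]_(u in B) Re (k * (cplx_of_pair u - a) ^+ j.+1) = 0.
Proof.
have w1 : rot35 ^+ j.+1 - 1 != 0 :> cplx R by rewrite subr_eq0 rot35_powN1.
pose k' : cplx R := k / (rot35 ^+ j.+1 - 1).
pose F (z : cplx R) : R := Re (k' * (z - a) ^+ j.+1).
have FE u : F (a + rot35 * (cplx_of_pair u - a)) =
    Re (k' * rot35 ^+ j.+1 * (cplx_of_pair u - a) ^+ j.+1).
  by rewrite /F [a + _]addrC addrK exprMn mulrA.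
(* k' is chosen so that F composed with the rotation, minus F, is the
   integrand *)
transitivity (\int[lebesgue2]_(u in B)
   (F (a + rot35 * (cplx_of_pair u - a)) - F (cplx_of_pair u))).
  apply: eq_Rintegral => u _; rewrite FE /F -raddfB /=; congr (Re _).
  by rewrite -mulrBl -[X in _ * _ - X]mulr1 -mulrBr /k' divfK.
rewrite RintegralB; last 3 first.
- exact: measurable_disc.
- by under eq_fun do rewrite /= FE; exact: integrable_monomial.
- exact: integrable_monomial.
rewrite -(@integral_disc_rot35 _ a r F) ?subrr //.
- exact: measurable_Re_mul_powX.
- by under eq_fun do rewrite FE; exact: integrable_monomial.
Qed.

Section PoleOutside.
Variable c : cplx R.
Hypothesis rc : r < normc (c - a).
Let d := c - a.
Let rho := r / normc d.
Let M := r / (normc d - r).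
(** What remains of w/(w - d) after N terms of its geometric series
    - sum_(k >= 1) (w/d)^k. *)
Let tail N (u : plane R) : cplx R :=
  ((cplx_of_pair u - a) / d) ^+ N * cauchy_quotient a c (cplx_of_pair u).

Let d0 : 0 < normc d. Proof. exact: lt_trans rc. Qed.
Let dn0 : d != 0. Proof. by rewrite -normc_gt0. Qed.

Let tail_le N u : B u -> `|Re (tail N u)| <= rho ^+ N * M.
Proof.
move=> /discE h; apply: le_trans (normr_Re_le _) _.
rewrite /tail Normc.normcM normcX Normc.normcM Normc.normcV.
apply: ler_pM; rewrite ?exprn_ge0 ?divr_ge0 ?normc_ge0 //.
  rewrite lerXn2r ?nnegrE ?divr_ge0 ?normc_ge0 ?(ltW r0) //.
  by rewrite ler_pM2r ?invr_gt0 ?(ltW h).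
rewrite normc_cauchy_quotient /M; apply: ler_pM; rewrite ?invr_ge0 ?normc_ge0 ?(ltW h) //.
have : normc d <= normc (cplx_of_pair u - a) + normc (cplx_of_pair u - c).
  rewrite [X in _ + X]normcBC.
  have -> : d = (cplx_of_pair u - a) + (c - cplx_of_pair u) by rewrite /d; ring.
  exact: normc_le_add.
have rd : r < normc d := rc.
by move=> h2; rewrite lef_pV2 ?posrE; lra.
Qed.

Let integrable_tail N : lebesgue2.-integrable B (fun u => (Re (tail N u))%:E).
Proof.
apply: (integrable_bounded (M := rho ^+ N * M)).
- exact: measurable_disc.
- exact: area_disc_fin.
- suff [] : cmeasurable (tail N) by [].
  apply: cmeasurableM; last exact: cmeasurable_cauchy_quotient.
  apply: cmeasurableX; apply: cmeasurableM; last exact: cmeasurable_cst.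
  by apply: cmeasurableB; [exact: cmeasurable_id|exact: cmeasurable_cst].
- exact: tail_le.
Qed.

Let tailS N u : B u ->
  tail N u = - (d^-1 ^+ N.+1 * (cplx_of_pair u - a) ^+ N.+1) + tail N.+1 u.
Proof.
move=> /discE h.
have zc : cplx_of_pair u - c != 0.
  rewrite subr_eq0; apply/eqP => zc; move: h rc; rewrite zc; lra.
rewrite /tail /cauchy_quotient -exprMn ![d^-1 * _]mulrC !exprS.
set x := (_ / d) ^+ N; rewrite -[LHS]mulr1.
move: dn0 zc; rewrite /d; set z := cplx_of_pair u.
by move=> *; field; apply/andP.
Qed.

(** Each monomial integrates to zero, so only the remainder contributes; it is
    bounded by a constant times (r/|d|)^N, for every N. *)
Lemma mean_value_pole_outside :
  \int[lebesgue2]_(u in B) Re (cauchy_quotient a c (cplx_of_pair u)) = 0.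
Proof.
have E N : \int[lebesgue2]_(u in B) Re (cauchy_quotient a c (cplx_of_pair u)) =
    \int[lebesgue2]_(u in B) Re (tail N u).
  elim: N => [|N ->]; first by apply: eq_Rintegral => u _; rewrite /tail expr0 mul1r.
  transitivity (\int[lebesgue2]_(u in B) (Re (- (d^-1 ^+ N.+1) *
      (cplx_of_pair u - a) ^+ N.+1) + Re (tail N.+1 u))).
    apply: eq_Rintegral => u /set_mem Bu.
    by rewrite (tailS _ Bu) -raddfD /= mulNr.
  rewrite RintegralD ?integral_monomial ?add0r //.
  - exact: measurable_disc.
  - exact: integrable_monomial.
  - exact: integrable_tail.
have A0 : 0 <= fine (lebesgue2 B) by rewrite fine_ge0.
have rho01 : 0 <= rho < 1.
  by rewrite divr_ge0 ?(ltW r0) ?normc_ge0 //= ltr_pdivrMr // mul1r.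
have M0 : 0 <= M by rewrite divr_ge0 ?(ltW r0) // subr_ge0 ltW.
have le N : `|\int[lebesgue2]_(u in B) Re (cauchy_quotient a c (cplx_of_pair u))|
    <= geometric (M * fine (lebesgue2 B)) rho N.
  rewrite (E N); apply: le_trans (le_normr_Rintegral measurable_disc (integrable_tail N)) _.
  apply: (@le_trans _ _ (\int[lebesgue2]_(u in B) (rho ^+ N * M))).
    apply: le_Rintegral => //; first exact: measurable_disc.
    - exact: (integrable_norm (integrable_tail N)).
    - by apply: integrable_constant; [exact: measurable_disc|exact: area_disc_fin].
    - exact: tail_le.
  rewrite Rintegral_cst /geometric /=; last exact: measurable_disc.
  by rewrite le_eqVlt; apply/orP; left; apply/eqP; ring.
apply/eqP; rewrite -normr_le0; apply/ler_addgt0Pr => e e0; rewrite add0r.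
have : (geometric (M * fine (lebesgue2 B)) rho N @[N --> \oo] --> 0)%classic.
  by apply: cvg_geometric; case/andP: rho01 => h1 h2; rewrite ger0_norm.
move=> /cvgrPdist_lt/(_ _ e0)[N _ /(_ N (leqnn N))].
rewrite sub0r normrN => /ltW; apply: le_trans; apply: le_trans (le N) _.
exact: ler_norm.
Qed.

End PoleOutside.

End MeanValue.

(** * Dependence of the quotient on its pole *)

Section RealEstimates.
Context {R : realType}.

Lemma powR_N32 (s : R) : 0 <= s -> s `^ (- (3 / 2)) = (Num.sqrt s) ^- 3.
Proof.
move=> s0; rewrite -powR12_sqrt // -powR_invn ?powR_ge0 // -powRrM.
by congr (_ `^ _); field.
Qed.

(** As e^(1/2) <= s^(1/2) + t^(1/2), division by e^(1/2) reduces the claim to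
    s^(1/2) + t^(1/2) <= (s^(3/2) + t^(3/2)) / (s t)^(1/2). *)
Lemma quotient_le_powN32 (e s t : R) : 0 <= e -> 0 < s -> 0 < t -> e <= s + t ->
  e / (s * t) <= Num.sqrt e * (s `^ (- (3 / 2)) + t `^ (- (3 / 2))).
Proof.
move=> e0 s0 t0 est; rewrite !powR_N32 ?(ltW s0) ?(ltW t0) //.
have := sqr_sqrtr e0; have := sqr_sqrtr (ltW s0); have := sqr_sqrtr (ltW t0).
have := sqrtr_ge0 e; move: s0 t0; rewrite -(sqrtr_gt0 s) -(sqrtr_gt0 t).
set E := Num.sqrt e; set S := Num.sqrt s; set T := Num.sqrt t.
move=> S0 T0 E0 tE sE eE; rewrite -eE -sE -tE in est *.
have EST : E <= S + T.
  rewrite -(ler_pXn2r (n := 2)) ?nnegrE ?addr_ge0 ?(ltW S0) ?(ltW T0) //.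
  rewrite (le_trans est) //.
  by rewrite sqrrD addrAC lerDl mulrn_wge0 // mulr_ge0 // ltW.
have -> : E ^+ 2 / (S ^+ 2 * T ^+ 2) = E * (E / (S ^+ 2 * T ^+ 2)) by ring.
rewrite ler_wpM2l //.
have -> : S ^- 3 + T ^- 3 = ((S ^+ 3 + T ^+ 3) / (S * T)) / (S ^+ 2 * T ^+ 2).
  by field; rewrite !gt_eqF.
rewrite ler_pM2r ?invr_gt0 ?mulr_gt0 ?exprn_gt0 //.
rewrite (le_trans EST) // ler_pdivlMr ?mulr_gt0 //.
have : 0 <= (S + T) * (S - T) ^+ 2 by rewrite mulr_ge0 ?sqr_ge0 // addr_ge0 ?ltW.
by move=> ?; nra.
Qed.

Lemma le0_of_le_mul_small (x K : R) :
  (forall e, 0 < e <= 1 -> x <= K * e) -> x <= 0.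
Proof.
move=> h; rewrite leNgt; apply/negP => x0.
have k0 : 0 < `|K| + 1 by rewrite ltr_wpDl.
pose e := Num.min 1 (x / (2 * (`|K| + 1))).
have e0 : 0 < e by rewrite lt_min ltr01 divr_gt0 // mulr_gt0.
have e1 : e <= 1 by rewrite ge_min lexx.
have ex : e * (2 * (`|K| + 1)) <= x.
  by rewrite -ler_pdivlMr ?mulr_gt0 // ge_min lexx orbT.
have := h e; rewrite e0 e1 => /(_ isT) hx.
have : K * e <= `|K| * e by rewrite ler_wpM2r ?ler_norm // ltW.
by move=> ?; nra.
Qed.

End RealEstimates.

Section PoleContinuity.
Context {R : realType}.
Implicit Types (a b c z : cplx R) (D : set (cplx R)).

(** The difference of the quotients is (z - a)(b - c)/((z - b)(z - c)); half of
    the smallness of b - c is spent on keeping the two singularities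
    integrable. *)
Lemma Re_cauchy_quotientB_le a b c z (L : R) : normc (z - a) <= L ->
  Re (cauchy_quotient a b z) - Re (cauchy_quotient a c z) <=
  L * Num.sqrt (normc (b - c)) *
    (normc (z - b) `^ (- (3 / 2)) + normc (z - c) `^ (- (3 / 2))).
Proof.
move=> zaL; have L0 : 0 <= L by apply: le_trans zaL; exact: normc_ge0.
rewrite -raddfB /=.
have [->|bc] := eqVneq b c.
  by rewrite !subrr Normc.normc0 sqrtr0 mulr0 mul0r raddf0.
apply: le_trans (ler_norm _) _; apply: le_trans (normr_Re_le _) _.
have bc0 : 0 < normc (b - c) by rewrite normc_gt0 subr_eq0.
(* at a pole the quotient and the negative power are both 0, and the bound
   reduces to the value of the other quotient there *)
have pole (t : R) : 0 < t -> t^-1 = Num.sqrt t * t `^ (- (3 / 2)).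
  move=> t0; rewrite powR_N32 ?(ltW t0) // -{1}(sqr_sqrtr (ltW t0)).
  by move: t0; rewrite -sqrtr_gt0 => t0; field; rewrite gt_eqF.
have e32 : - (3 / 2) != 0 :> R by rewrite oppr_eq0; apply/eqP; lra.
have [zb|zb] := eqVneq z b.
  rewrite zb subrr Normc.normc0 powR0 // add0r -mulrA -pole //.
  rewrite {1}/cauchy_quotient subrr invr0 mulr0 sub0r normcN normc_cauchy_quotient.
  by rewrite ler_pM2r ?invr_gt0 // -zb.
have [zc|zc] := eqVneq z c.
  rewrite zc subrr Normc.normc0 powR0 // addr0 normcBC -mulrA.
  rewrite [normc (c - b)]normcBC -pole //.
  rewrite {2}/cauchy_quotient subrr invr0 mulr0 subr0 normc_cauchy_quotient.
  by rewrite [normc (c - b)]normcBC ler_pM2r ?invr_gt0 // -zc.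
have zb0 : 0 < normc (z - b) by rewrite normc_gt0 subr_eq0.
have zc0 : 0 < normc (z - c) by rewrite normc_gt0 subr_eq0.
have -> : cauchy_quotient a b z - cauchy_quotient a c z =
    (z - a) * ((b - c) / ((z - b) * (z - c))).
  rewrite /cauchy_quotient; field.
  by rewrite !subr_eq0 zb zc.
rewrite Normc.normcM -mulrA; apply: ler_pM; rewrite ?normc_ge0 //.
rewrite Normc.normcM Normc.normcV Normc.normcM.
apply: quotient_le_powN32 => //; first exact: ltW.
rewrite [normc (z - b)]normcBC.
have -> : b - c = (b - z) + (z - c) by ring.
exact: normc_le_add.
Qed.

(** Continuity in the pole, locally uniform: the singularity of order 3/2 has
    integral bounded independently of its position. *)
Lemma integral_cauchy_quotient_pole (a : cplx R) (L : R) : 0 < L ->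
  exists2 K : R, 0 <= K & forall D b c, measurable (pre D) ->
    (forall z, D z -> normc (z - a) <= L) ->
    D `<=` open_square b L -> D `<=` open_square c L ->
    \int[lebesgue2]_(u in pre D) Re (cauchy_quotient a b (cplx_of_pair u)) -
    \int[lebesgue2]_(u in pre D) Re (cauchy_quotient a c (cplx_of_pair u)) <=
    K * Num.sqrt (normc (b - c)).
Proof.
move=> L0.
have q02 : 0 < (3 / 2 : R) < 2 by apply/andP; split; lra.
have q1 : 1 <= 3 / 2 :> R by lra.
have [C HC] := integral_modulus_powN q02 L0.
have C0 : 0 <= C.
  rewrite -lee_fin; apply: le_trans (HC 0); apply: integral_ge0 => u _.
  by rewrite lee_fin powR_ge0.
exists (L * (C + C)) => [|D b c mD Da Db Dc]; first by rewrite mulr_ge0 ?addr_ge0 // ltW.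
have fD : (lebesgue2 (pre D) < +oo)%E.
  apply: (@le_lt_trans _ _ (area (open_square b L))).
    by apply: le_area => //; exact: measurable_open_square.
  by rewrite area_open_square // ltry.
have iq e : D `<=` open_square e L -> lebesgue2.-integrable (pre D)
    (fun u => (Re (cauchy_quotient a e (cplx_of_pair u)))%:E).
  move=> De; apply: (integrable_Re_powR q1) => //.
    exact: cmeasurable_cauchy_quotient.
  exact: (integrable_cauchy_quotient_powR (L := L)).
have mf e : measurable_fun setT (fun u => normc (cplx_of_pair u - e) `^ (- (3 / 2))).
  apply: measurable_normc_powR.
  by apply: cmeasurableB; [exact: cmeasurable_id|exact: cmeasurable_cst].
have bnd e : D `<=` open_square e L ->
    (\int[lebesgue2]_(u in pre D) (normc (cplx_of_pair u - e) `^ (- (3 / 2)))%:E <= C%:E)%E.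
  move=> De; apply: le_trans (HC e); apply: ge0_subset_integral => //.
  - exact: measurable_open_square.
  - by apply/measurable_EFinP/measurable_funTS; exact: mf.
  - by move=> u _; rewrite lee_fin powR_ge0.
  - by move=> u; exact: De.
have ie e : D `<=` open_square e L -> lebesgue2.-integrable (pre D)
    (fun u => (normc (cplx_of_pair u - e) `^ (- (3 / 2)))%:E).
  move=> De; apply/integrableP; split.
    by apply/measurable_EFinP/measurable_funTS; exact: mf.
  under eq_integral do rewrite gee0_abs ?lee_fin ?powR_ge0 //.
  exact: le_lt_trans (bnd e De) (ltry _).
have bndR e : D `<=` open_square e L ->
    \int[lebesgue2]_(u in pre D) normc (cplx_of_pair u - e) `^ (- (3 / 2)) <= C.
  move=> De; rewrite -lee_fin /Rintegral fineK; first exact: bnd.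
  exact: (integrable_fin_num mD (ie e De)).
rewrite -RintegralB //; [|exact: iq|exact: iq].
apply: (@le_trans _ _ (\int[lebesgue2]_(u in pre D)
   (L * Num.sqrt (normc (b - c)) * (normc (cplx_of_pair u - b) `^ (- (3 / 2)) +
      normc (cplx_of_pair u - c) `^ (- (3 / 2)))))).
  apply: le_Rintegral => //.
  - exact: (integrableB mD (iq b Db) (iq c Dc)).
  - by apply: integrable_scale => //; apply: integrable_add => //; exact: ie.
  - by move=> u Du; apply: Re_cauchy_quotientB_le; exact: Da.
rewrite RintegralZl //; last by apply: integrable_add => //; exact: ie.
rewrite RintegralD //; [|exact: ie|exact: ie].
rewrite mulrAC ler_wpM2r ?sqrtr_ge0 // ler_wpM2l ?(ltW L0) //.
by apply: lerD; exact: bndR.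
Qed.

(** Push the pole b out along its radius and let it return. *)
Lemma mean_value_pole_boundary a b (r : R) : 0 < r -> normc (b - a) = r ->
  \int[lebesgue2]_(u in pre (open_disc a r))
    Re (cauchy_quotient a b (cplx_of_pair u)) = 0.
Proof.
move=> r0 br.
have L0 : 0 < 3 * r by lra.
have [K K0 HK] := integral_cauchy_quotient_pole a L0.
apply/eqP; rewrite -normr_le0.
apply: (@le0_of_le_mul_small _ _ (K * Num.sqrt r)) => e /andP[e0 e1].
(* with this shift the square root in the modulus of continuity is linear
   in e *)
pose c : cplx R := b + (e ^+ 2)%:C * (b - a).
have cb : normc (c - b) = e ^+ 2 * r.
  rewrite /c addrAC subrr add0r Normc.normcM br normc_real ger0_norm //.
  by rewrite sqr_ge0.
have ca : r < normc (c - a).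
  have -> : c - a = (1 + (e ^+ 2)%:C) * (b - a) by rewrite /c; ring.
  rewrite Normc.normcM br -[1]/(1%:C) -rmorphD normc_real ger0_norm; last first.
    by rewrite addr_ge0 // sqr_ge0.
  by rewrite ltr_pMl // ltrDl exprn_gt0.
have zr z : open_disc a r z -> normc (z - a) < r by rewrite open_discE normcBC.
have Dsq x : normc (x - a) <= 2 * r -> open_disc a r `<=` open_square x (3 * r).
  move=> xa z /zr za; apply: sub_open_disc_square; rewrite open_discE.
  have -> : x - z = (x - a) - (z - a) by ring.
  apply: le_lt_trans (normc_le_add _ _) _; rewrite normcN; lra.
have Db : open_disc a r `<=` open_square b (3 * r) by apply: Dsq; lra.
have Dc : open_disc a r `<=` open_square c (3 * r).
  apply: Dsq; have -> : c - a = (c - b) + (b - a) by ring.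
  apply: le_trans (normc_le_add _ _) _; rewrite cb br.
  have : e ^+ 2 * r <= 1 * r by rewrite ler_pM2r // expr_le1 // ltW.
  by move=> ?; lra.
have Da z : open_disc a r z -> normc (z - a) <= 3 * r by move=> /zr ?; lra.
have mD : measurable (pre (open_disc a r)) by exact: measurable_disc.
have sq : Num.sqrt (normc (c - b)) = Num.sqrt r * e.
  by rewrite cb sqrtrM ?sqr_ge0 // sqrtr_sqr ger0_norm ?(ltW e0) // mulrC.
have h1 := HK _ b c mD Da Db Dc; have h2 := HK _ c b mD Da Dc Db.
move: h1 h2; rewrite (mean_value_pole_outside r0 ca) [normc (b - c)]normcBC sq.
rewrite subr0 sub0r mulrA => h1 h2.
by rewrite ler_norml h1 andbT lerNl.
Qed.

End PoleContinuity.

(** * Perturbing the constant function 1 *)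

Section Expansion.
Context {R : realType}.

(** From 1 - y <= exp(-y), the bound 1/(1 - y) holds, and it lies below the
    polynomial as long as y <= 1/2. *)
Lemma expR_le_quadratic (y : R) : y <= 1 / 2 -> expR y <= 1 + y + 2 * y ^+ 2.
Proof.
move=> y2; have h : 1 - y <= expR (- y) by have := expR_ge1Dx (- y).
have y1 : 0 < 1 - y by lra.
have : expR y <= (1 - y)^-1.
  by rewrite -[expR y]invrK -expRN lef_pV2 ?posrE ?expR_gt0.
move=> /le_trans; apply; rewrite -[X in X <= _]mul1r ler_pdivrMr //.
by have := sqr_ge0 y; nra.
Qed.

(** The exponent 3/2 is a choice in the open interval (1, 2): above 1, so that
    the error is negligible against the first order term when w is scaled, and
    below 2, so that simple poles may be inserted for w.
    Near 0 this is the second order expansion of (1 + x)^(p/2) with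
    x = 2 Re w + |w|^2; away from 0 every term is dominated by |w|^m. *)
Lemma normc_1D_powR_le (p : R) : 0 < p -> exists2 C : R, 0 <= C &
  forall w : R[i], normc (1 + w) `^ p <= 1 + p * Re w +
    C * (normc w `^ (3 / 2) + normc w `^ (Num.max p (3 / 2))).
Proof.
move=> p0; set m := Num.max p (3 / 2).
have m1 : 1 <= m by rewrite le_max; apply/orP; right; lra.
have pm : p <= m by rewrite le_max lexx.
(* below d, the exponent (p/2) x is at most 1/2, because |x| <= 3 |w| *)
pose d : R := Num.min 1 (1 / (3 * p)).
have d0 : 0 < d by rewrite lt_min ltr01 divr_gt0 // mulr_gt0.
have d1 : d <= 1 by rewrite ge_min lexx.
have dp : 3 * p * d <= 1.
  by rewrite mulrC -ler_pdivlMr ?mulr_gt0 // ge_min lexx orbT.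
pose C1 : R := p / 2 + 9 / 2 * p ^+ 2.
pose C2 : R := (1 + d) `^ p * d `^ (- m) + p * d `^ (- m).
have C10 : 0 <= C1 by rewrite addr_ge0 ?mulr_ge0 ?sqr_ge0 ?ltW //; lra.
have C20 : 0 <= C2 by rewrite addr_ge0 ?mulr_ge0 ?powR_ge0 ?ltW.
exists (C1 + C2) => [|w]; first exact: addr_ge0.
have w0 := normc_ge0 w; have Rw := normr_Re_le w.
have [wd|dw] := leP (normc w) d.
  pose x : R := 2 * Re w + normc w ^+ 2.
  have xE : normc (1 + w) ^+ 2 = 1 + x.
    rewrite sqr_normcE /x sqr_normcE; case: (w) => u v /=; ring.
  have xle : `|x| <= 3 * normc w.
    rewrite (le_trans (ler_normD _ _)) // normrM (ger0_norm (sqr_ge0 _)).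
    rewrite (ger0_norm (_ : 0 <= 2)) //.
    have : normc w ^+ 2 <= normc w by rewrite expr2 ler_piMr // (le_trans wd).
    by move=> ?; lra.
  have x1 : 0 <= 1 + x by rewrite -xE sqr_ge0.
  have -> : normc (1 + w) `^ p = (1 + x) `^ (p / 2).
    have {1}-> : p = 2%:R * (p / 2) by field.
    by rewrite -xE powRrM powR_mulrn ?normc_ge0.
  apply: (@le_trans _ _ (expR (p / 2 * x))).
    have := x1; rewrite le_eqVlt => /orP[/eqP <-|x1'].
      by rewrite powR0 ?expR_ge0 // gt_eqF // divr_gt0.
    rewrite /powR gt_eqF // ler_expR ler_wpM2l ?divr_ge0 ?(ltW p0) //.
    by rewrite -[leRHS]expRK ler_ln ?posrE ?expR_gt0 // expR_ge1Dx.
  have xle' : x <= 3 * normc w by rewrite (le_trans (ler_norm _)).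
  apply: le_trans (expR_le_quadratic _) _.
    have : p * x <= p * (3 * d) by rewrite ler_pM2l // (le_trans xle') // ler_pM2l.
    by move=> ?; lra.
  have sq : normc w ^+ 2 <= normc w `^ (3 / 2).
    have := w0; rewrite le_eqVlt => /orP[/eqP <-|w0'].
      by rewrite expr2 mul0r powR_ge0.
    rewrite -powR_mulrn //; apply: ger_powR; last by lra.
    by rewrite w0' (le_trans wd).
  have x2 : x ^+ 2 <= 9 * normc w ^+ 2.
    have : `|x| ^+ 2 <= (3 * normc w) ^+ 2.
      by rewrite ler_pXn2r ?nnegrE ?mulr_ge0.
    rewrite real_normK ?num_real // exprMn => h.
    by move: h; rewrite (_ : 3 ^+ 2 = 9 :> R) //; ring.
  have E : 1 + p / 2 * x + 2 * (p / 2 * x) ^+ 2 <= 1 + p * Re w + C1 * normc w ^+ 2.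
    have : p ^+ 2 * x ^+ 2 <= p ^+ 2 * (9 * normc w ^+ 2) by rewrite ler_wpM2l ?sqr_ge0.
    by rewrite /C1 /x; move=> ?; nra.
  apply: le_trans E _; rewrite lerD2l [leRHS]mulrDl.
  apply: ler_wpDr; first by rewrite mulr_ge0 // addr_ge0 ?powR_ge0.
  by rewrite ler_wpM2l // (le_trans sq) // lerDl powR_ge0.
have w0' : 0 < normc w by exact: lt_trans dw.
(* above d, the powers of v = |w|/d >= 1 increase with the exponent *)
pose v := normc w / d.
have v1 : 1 <= v by rewrite /v ler_pdivlMr // mul1r ltW.
have vm : v `^ m = d `^ (- m) * normc w `^ m.
  by rewrite /v powRM ?invr_ge0 ?(ltW d0) // -powR_inv1 ?(ltW d0) // -powRrM mulN1r mulrC.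
have h1 : normc (1 + w) `^ p <= (1 + d) `^ p * v `^ m.
  apply: (@le_trans _ _ (((1 + d) * v) `^ p)).
    have : normc (1 + w) <= (1 + d) * v.
      apply: le_trans (normc_le_add _ _) _; rewrite Normc.normc1 mulrDl mul1r.
      by apply: lerD => //; rewrite /v mulrC divfK // gt_eqF.
    apply: ge0_ler_powR; rewrite ?nnegrE ?normc_ge0 ?(ltW p0) //.
    by rewrite mulr_ge0 // ?addr_ge0 ?(ltW d0) // (le_trans _ v1).
  rewrite powRM ?addr_ge0 ?(ltW d0) // ?(le_trans _ v1) //.
  by rewrite ler_wpM2l ?powR_ge0 // ler_powR.
have h2 : - Re w <= v `^ m.
  apply: le_trans (ler_norm _) _; rewrite normrN (le_trans Rw) //.
  apply: (@le_trans _ _ v); last exact: le1r_powR.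
  by rewrite /v ler_pdivlMr // ger_pMr.
have h3 : p * - Re w <= p * v `^ m by rewrite ler_pM2l.
have h4 : C2 * normc w `^ m <= (C1 + C2) * (normc w `^ (3 / 2) + normc w `^ m).
  by apply: ler_pM => //; rewrite ?powR_ge0 ?lerDr ?powR_ge0.
have h5 : C2 * normc w `^ m = (1 + d) `^ p * v `^ m + p * v `^ m.
  by rewrite vm /C2; ring.
lra.
Qed.

End Expansion.

Section Minimiser.
Context {R : realType}.
Implicit Types (Omega : set (cplx R)) (a z : cplx R) (h : cplx R -> cplx R).

(** An extremal kernel value says that the constant 1 has least norm among the
    competitors. *)
Lemma area_le_of_kernel Omega a (p : R) f : 0 < p -> (0 < area Omega < +oo)%E ->
  bergman_kernel Omega p a = 1 / fine (area Omega) ->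
  bergman_space Omega p f -> f a = 1 ->
  (area Omega <= \int[lebesgue2]_(u in pre Omega)
     ((normc (f (cplx_of_pair u)) `^ p)%R)%:E)%E.
Proof.
move=> p0 /andP[A0 Aoo]; rewrite /bergman_kernel.
set S := [set fine _ | g in _]; set A := fine (area Omega).
have AE : area Omega = A%:E by rewrite fineK // ge0_fin_numE // ltW.
have A00 : 0 < A by rewrite -lte_fin -AE.
move=> SA fp fa.
have lb : lbound S 0 by move=> _ [g _ <-]; rewrite fine_ge0 // poweR_ge0.
have Sf : S (fine (Lp_norm Omega p f)) by exists f.
have i0 : 0 <= inf S by apply: lb_le_inf => //; exists (fine (Lp_norm Omega p f)).
have infE : inf S `^ p = A.
  move: SA; rewrite powRN div1r => /(congr1 (@GRing.inv R)); by rewrite !invrK.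
have : inf S <= fine (Lp_norm Omega p f) by apply: ge_inf => //; exists 0.
move=> h.
have : A <= fine (Lp_norm Omega p f) `^ p.
  by rewrite -infE; apply: ge0_ler_powR; rewrite ?nnegrE ?fine_ge0 ?poweR_ge0 ?(ltW p0).
rewrite AE; case: fp => _; rewrite /Lp_norm.
set I := (\int[_]_(_ in _) _)%E.
have I0 : (0 <= I)%E by apply: integral_ge0 => u _; rewrite lee_fin powR_ge0.
case: I I0 => [i i0'|_|//]; last by rewrite leey.
rewrite poweR_EFin => _ /=; rewrite -powRrM mulVf ?gt_eqF // powRr1 //.
Qed.

(** Compare 1 with 1 - e^2 h: the gain p e^2 Re h must be absorbed by an error
    of order e^3. *)
Lemma integral_Re_le0_of_kernel Omega a (p : R) h : open Omega -> 0 < p ->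
  (0 < area Omega < +oo)%E ->
  bergman_kernel Omega p a = 1 / fine (area Omega) ->
  holomorphic_on Omega h -> h a = 0 ->
  cmeasurable (fun u => h (cplx_of_pair u)) ->
  lebesgue2.-integrable (pre Omega)
    (fun u => (normc (h (cplx_of_pair u)) `^ (3 / 2))%:E) ->
  lebesgue2.-integrable (pre Omega)
    (fun u => (normc (h (cplx_of_pair u)) `^ (Num.max p (3 / 2)))%:E) ->
  \int[lebesgue2]_(u in pre Omega) Re (h (cplx_of_pair u)) <= 0.
Proof.
move=> oO p0 A0oo ker holh ha mh i32 im.
have /andP[A0 Aoo] := A0oo.
have mO : measurable (pre Omega) by exact: measurable_open.
have [C C0 HC] := normc_1D_powR_le p0.
set m := Num.max p (3 / 2) in im HC.
have m32 : 3 / 2 <= m by rewrite le_max lexx orbT.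
have q1 : 1 <= 3 / 2 :> R by lra.
have iRe : lebesgue2.-integrable (pre Omega) (fun u => (Re (h (cplx_of_pair u)))%:E).
  exact: (integrable_Re_powR q1).
pose J u : R := normc (h (cplx_of_pair u)) `^ (3 / 2) + normc (h (cplx_of_pair u)) `^ m.
have iJ : lebesgue2.-integrable (pre Omega) (fun u => (J u)%:E).
  exact: integrable_add.
apply: (@le0_of_le_mul_small _ _ (C * \int[lebesgue2]_(u in pre Omega) J u / p)).
move=> e /andP[e0 e1].
pose f z : cplx R := 1 + (- (e ^+ 2)%:C) * h z.
have e21 : e ^+ 2 <= 1 by rewrite expr_le1 // ltW.
have e20 : 0 < e ^+ 2 by rewrite exprn_gt0.
have ne : normc (- (e ^+ 2)%:C : cplx R) = e ^+ 2.
  by rewrite normcN normc_real ger0_norm // ltW.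
have e3 : (e ^+ 2) `^ (3 / 2) = e ^+ 3.
  by rewrite -!powR_mulrn ?(ltW e0) // -powRrM; congr (_ `^ _); field.
have em : (e ^+ 2) `^ m <= e ^+ 3.
  by rewrite -e3; apply: ger_powR => //; rewrite e20.
pose g u : R := (1 + (- (p * e ^+ 2)) * Re (h (cplx_of_pair u))) + C * e ^+ 3 * J u.
have fg u : normc (f (cplx_of_pair u)) `^ p <= g u.
  apply: le_trans (HC _) _; rewrite /g.
  set w := h _; have -> : Re (- (e ^+ 2)%:C * w) = - e ^+ 2 * Re w.
    by case: w => x y /=; ring.
  rewrite mulrA mulrN lerD2l -mulrA ler_wpM2l // Normc.normcM ne.
  have pw q : (e ^+ 2 * normc w) `^ q = (e ^+ 2) `^ q * normc w `^ q.
    by apply: powRM; rewrite ?normc_ge0 ?(ltW e20).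
  rewrite !pw e3 /J -/w mulrDr lerD2l.
  by rewrite ler_wpM2r ?powR_ge0.
have ig : lebesgue2.-integrable (pre Omega) (fun u => (g u)%:E).
  apply: integrable_add => //; last exact: integrable_scale.
  by apply: integrable_add => //; [exact: integrable_constant|exact: integrable_scale].
have mf : cmeasurable (fun u => f (cplx_of_pair u)).
  apply: cmeasurableD; first exact: cmeasurable_cst.
  by apply: cmeasurableM => //; exact: cmeasurable_cst.
have iff : lebesgue2.-integrable (pre Omega)
    (fun u => (normc (f (cplx_of_pair u)) `^ p)%:E).
  apply: (integrable_le _ _ ig) => //; first exact: measurable_normc_powR.
  by move=> u _; rewrite ger0_norm ?powR_ge0.
have Lf : bergman_space Omega p f.
  split.
    move=> z Oz; apply: derivableD; first exact: derivable_cst.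
    apply: derivableM; [exact: derivable_cst|exact: holh].
  rewrite /Lp_norm -[X in (X `^ _)%E](@fineK _) ?poweR_EFin ?ltry //.
  exact: (integrable_fin_num mO iff).
have fa : f a = 1 by rewrite /f ha mulr0 addr0.
have := area_le_of_kernel p0 A0oo ker Lf fa.
have AE : area Omega = (fine (area Omega))%:E.
  by rewrite fineK // ge0_fin_numE // ltW.
rewrite -[leRHS]fineK ?(integrable_fin_num mO iff) // AE lee_fin.
rewrite -/(Rintegral _ _ _).
have : \int[lebesgue2]_(u in pre Omega) normc (f (cplx_of_pair u)) `^ p <=
    \int[lebesgue2]_(u in pre Omega) g u by apply: le_Rintegral => // u _; exact: fg.
move=> h1 h2; have {h1 h2} := le_trans h2 h1.
rewrite /g RintegralD //; last 2 first.
- by apply: integrable_add => //; [exact: integrable_constant|exact: integrable_scale].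
- exact: integrable_scale.
rewrite RintegralD //; last 2 first.
- exact: integrable_constant.
- exact: integrable_scale.
rewrite Rintegral_cst // mul1r !RintegralZl // -/(area Omega).
set X := \int[_]_(_ in _) _; set Y := \int[_]_(_ in _) _.
move=> h1.
have h2 : e ^+ 2 * (p * X) <= e ^+ 2 * (C * Y * e).
  have : 0 <= - (p * e ^+ 2) * X + C * e ^+ 3 * Y.
    move: h1; rewrite /area; lra.
  by move=> ?; nra.
rewrite mulrAC ler_pdivlMr // mulrC.
by move: h2; rewrite ler_pM2l.
Qed.

End Minimiser.

(** * The part of a domain outside an inscribed disc *)

Section HalfPlane.
Context {R : realType}.
Implicit Types (a b c z : cplx R) (D : set (cplx R)).

(** The map w |-> w/(w - d) sends the outside of the circle |w| = |d| to the
    half-plane Re >= 1/2. *)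
Lemma Re_cauchy_quotient_ge a b z : z != b -> normc (b - a) <= normc (z - a) ->
  1 / 2 <= Re (cauchy_quotient a b z).
Proof.
rewrite -subr_eq0 -normc_gt0 => zb0 h.
have : normc (b - a) ^+ 2 <= normc (z - a) ^+ 2.
  by rewrite lerXn2r ?nnegrE ?normc_ge0.
have : 0 < normc (z - b) ^+ 2 by rewrite exprn_gt0.
rewrite !sqr_normcE /cauchy_quotient.
case: z a b {zb0 h} => x y [a1 a2] [b1 b2] /=.
set N := _ + _ => N0 h.
have -> : (x - a1) * ((x - b1) / N) - (y - a2) * - ((y - b2) / N) =
    ((x - a1) * (x - b1) + (y - a2) * (y - b2)) / N by ring.
rewrite ler_pdivlMr //; move: N0 h; rewrite /N; nra.
Qed.

Lemma Rintegral_null (N : set (plane R)) (f : plane R -> R) : measurable N ->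
  measurable_fun setT f -> lebesgue2 N = 0%E -> \int[lebesgue2]_(u in N) f u = 0.
Proof.
move=> mN mf N0; rewrite /Rintegral null_set_integral //.
by apply/measurable_EFinP/measurable_funTS.
Qed.

Section Excess.
Variables (D : set (cplx R)) (a : cplx R) (r M : R).
Hypotheses (oD : open D) (r0 : 0 < r) (M0 : 0 <= M).
Hypothesis DM : forall z, D z -> normc (z - a) <= M.
Hypothesis BD : area (open_disc a r `\` D) = 0%E.

Let L := M + 2 * r + 2.
Let B := open_disc a r.
(** Cutting out the closed disc keeps this set open, so that it is empty as
    soon as its area is zero; it also discards the pole, where the lower bound
    1/2 fails. *)
Let E := D `\` closed_disc a r.
Let f c u := Re (cauchy_quotient a c (@cplx_of_pair R u)).

Lemma open_excess : open E.
Proof.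
apply/openP_disc => z [Dz]; rewrite closed_discE => /negP; rewrite -ltNge => rz.
have [e e0 eD] := iffLR (openP_disc D) oD _ Dz.
exists (Num.min e (normc (a - z) - r)); first by rewrite lt_min e0 subr_gt0.
move=> w; rewrite open_discE lt_min => /andP[we wr]; split.
  by apply: eD; rewrite open_discE.
rewrite closed_discE; apply/negP; rewrite -ltNge.
have -> : a - w = (a - z) - (w - z) by ring.
have := normc_le_add ((a - z) - (w - z)) (w - z).
by rewrite subrK [normc (w - z)]normcBC => h; lra.
Qed.

Let mD : measurable (pre D). Proof. exact: measurable_open. Qed.
Let mB : measurable (pre B). Proof. exact: measurable_disc. Qed.
Let mE : measurable (pre E). Proof. by apply: measurable_open; exact: open_excess. Qed.

Lemma sub_square_excess c : normc (c - a) <= r + 1 ->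
  D `|` B `<=` open_square c L.
Proof.
move=> ca z Sz; have [r0' M0'] := (r0, M0); apply: sub_open_disc_square; rewrite open_discE.
have za : normc (z - a) <= M + r.
  case: Sz => [/DM|]; first by move=> ?; lra.
  by rewrite /B open_discE normcBC => ?; lra.
have -> : c - z = (c - a) - (z - a) by ring.
apply: le_lt_trans (normc_le_add _ _) _; rewrite normcN /L; lra.
Qed.

(** The disc contributes 0 by the mean value property; outside of it the
    integrand is at least 1/2, except at the pole where it is 0. *)
Lemma area_excess_le c : normc (c - a) = r ->
  fine (area E) <= 2 * \int[lebesgue2]_(u in pre D) f c u.
Proof.
move=> cr; have [r0' M0'] := (r0, M0).
have L0 : 0 < L by rewrite /L; lra.
have mf : measurable_fun setT (f c) by case: (cmeasurable_cauchy_quotient a c).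
have cL : normc (c - a) <= r + 1 by rewrite cr lerDl.
have mDB : measurable (pre (D `|` B)) by exact: measurableU.
have fin : (lebesgue2 (pre (D `|` B)) < +oo)%E.
  apply: (area_fin _ L0 (sub_square_excess cL)).
  by apply: openU => //; exact: open_open_disc.
have q02 : 0 < (3 / 2 : R) < 2 by apply/andP; split; lra.
have iDB : lebesgue2.-integrable (pre (D `|` B)) (fun u => (f c u)%:E).
  apply: (@integrable_Re_powR _ _ _ (3 / 2)) => //; first by lra.
    exact: cmeasurable_cauchy_quotient.
  apply: (integrable_cauchy_quotient_powR L0 q02 mDB (sub_square_excess cL)).
  move=> z [/DM|]; first by move=> ?; rewrite /L; lra.
  by rewrite /B open_discE normcBC /L => ?; lra.
have iS (S : set (plane R)) : measurable S -> S `<=` pre (D `|` B) ->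
    lebesgue2.-integrable S (fun u => (f c u)%:E).
  by move=> mS SS; exact: (integrableS mDB mS SS).
have BD0 : \int[lebesgue2]_(u in pre B `\` pre D) f c u = 0.
  by apply: Rintegral_null => //; exact: measurableD.
have split S T : measurable S -> measurable T -> S `<=` pre (D `|` B) ->
    \int[lebesgue2]_(u in S) f c u =
    \int[lebesgue2]_(u in S `&` T) f c u + \int[lebesgue2]_(u in S `\` T) f c u.
  move=> mS mT SS; rewrite -[in LHS](setUIDK S T) Rintegral_setU //.
  - exact: measurableI.
  - exact: measurableD.
  - by rewrite setUIDK; exact: iS.
  - by apply/disj_setPS => u [[_ Tu] [_ /(_ Tu)]].
have DB0 : \int[lebesgue2]_(u in pre D `&` pre B) f c u = 0.
  have := split (pre B) (pre D) mB mD (fun u Bu => or_intror Bu).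
  by rewrite BD0 addr0 setIC => <-; exact: mean_value_pole_boundary.
rewrite (split _ _ mD mB (fun u Du => or_introl Du)) DB0 add0r.
have mDB' : measurable (pre D `\` pre B) by exact: measurableD.
have EDB : (pre D `\` pre B) `&` pre E = pre E.
  apply/seteqP; split=> u [] // Du nBu; split=> //; split=> // Bu; apply: nBu.
  by move: Bu; rewrite /preimage /B /= open_discE closed_discE => /ltW.
have sub : pre D `\` pre B `<=` pre (D `|` B) by move=> u [Du _]; left.
have f_ge u : pre D u -> ~ pre B u -> cplx_of_pair u != c -> 1 / 2 <= f c u.
  move=> Du nBu uc; apply: Re_cauchy_quotient_ge => //; rewrite cr leNgt.
  by apply/negP => h; apply: nBu; rewrite /preimage /B /= open_discE normcBC.
rewrite (split _ _ mDB' mE sub) EDB.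
have h1 : 0 <= \int[lebesgue2]_(u in pre D `\` pre B `\` pre E) f c u.
  apply: Rintegral_ge0 => u [[Du nBu] _].
  have [uc|uc] := eqVneq (cplx_of_pair u) c.
    by rewrite /f uc /cauchy_quotient subrr invr0 mulr0.
  by apply: le_trans (f_ge _ Du nBu uc); lra.
have h2 : 1 / 2 * fine (area E) <= \int[lebesgue2]_(u in pre E) f c u.
  rewrite -(Rintegral_cst _ mE); apply: le_Rintegral => //.
  - apply: integrable_constant => //; apply: le_lt_trans fin.
    by apply: le_area => // z [Dz _]; left.
  - by apply: iS => // u [Du _]; left.
  move=> u [Du]; rewrite closed_discE => /negP; rewrite -ltNge => ru.
  apply: f_ge => //.
    by rewrite /preimage /B /= open_discE => h; lra.
  by apply/eqP => uc; move: ru; rewrite uc normcBC cr ltxx.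
lra.
Qed.

(** The pole b is moved radially to the circle, where the excess of D over the
    disc is controlled; the cost of the move vanishes with |b - a| - r. *)
Lemma sub_closed_disc_of_integral_le0 :
  (forall e, 0 < e -> exists b, [/\ r <= normc (b - a), normc (b - a) < r + e &
     \int[lebesgue2]_(u in pre D) f b u <= 0]) ->
  D `<=` closed_disc a r.
Proof.
move=> Hb; have [r0' M0'] := (r0, M0).
have L0 : 0 < L by rewrite /L; lra.
have [K K0 HK] := integral_cauchy_quotient_pole a L0.
have E0 : fine (area E) <= 0.
  apply: (@le0_of_le_mul_small _ _ (2 * K)) => e /andP[e0 e1].
  have e20 : 0 < e ^+ 2 by rewrite exprn_gt0.
  have e21 : e ^+ 2 <= 1 by rewrite expr_le1 // ltW.
  have [b [rb be b0]] := Hb _ e20.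
  have nb0 : 0 < normc (b - a) by exact: lt_le_trans rb.
  pose t := r / normc (b - a).
  have t0 : 0 < t by rewrite divr_gt0.
  pose c : cplx R := a + t%:C * (b - a).
  have cr : normc (c - a) = r.
    rewrite /c [a + _]addrC addrK Normc.normcM normc_real gtr0_norm //.
    by rewrite /t divfK // gt_eqF.
  have cb : normc (c - b) <= e ^+ 2.
    have -> : c - b = (t - 1)%:C * (b - a).
      by rewrite /c rmorphB rmorph1; ring.
    rewrite Normc.normcM normc_real -[X in _ * X](gtr0_norm nb0) -normrM mulrBl mul1r.
    by rewrite /t divfK ?gt_eqF // ler_norml; apply/andP; split; lra.
  have h := area_excess_le cr.
  have Da z : D z -> normc (z - a) <= L by move=> /DM ?; rewrite /L; lra.
  have Dc : D `<=` open_square c L.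
    by move=> z Dz; apply: sub_square_excess; [rewrite cr lerDl|left].
  have Db : D `<=` open_square b L.
    by move=> z Dz; apply: sub_square_excess; [lra|left].
  have h2 := HK D c b mD Da Dc Db.
  have h3 : Num.sqrt (normc (c - b)) <= e.
    by rewrite -[e]gtr0_norm // -sqrtr_sqr ler_wsqrtr.
  have h4 : K * Num.sqrt (normc (c - b)) <= K * e by rewrite ler_wpM2l.
  have h5 : \int[lebesgue2]_(u in pre D) f c u <= K * e.
    by move: h2 b0; rewrite /f; lra.
  by rewrite -mulrA; apply: le_trans h _; rewrite ler_pM2l.
move=> z Dz; apply: contrapT => nz.
have Ez : E !=set0 by exists z.
have := area_gt0 open_excess Ez.
have Efin : (area E < +oo)%E.
  apply: (@area_fin _ E a L) => //; first exact: open_excess.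
  by move=> w [Dw _]; apply: sub_square_excess; [rewrite subrr Normc.normc0; lra|left].
by rewrite -[area E]fineK ?ge0_fin_numE // lte_fin ltNge E0.
Qed.

End Excess.
End HalfPlane.

(** * Rigidity *)

Section Conclusion.
Context {R : realType}.
Implicit Types (a b z : cplx R) (E D : set (cplx R)).

(** The radius is the distance from a to the complement; that distance is only
    approached by points b, which spares any compactness argument. *)
Lemma exists_inscribed_disc E a (M : R) : (forall z, E z -> normc z <= M) ->
  nbhs a E -> exists r : R, [/\ 0 < r, open_disc a r `<=` E &
    forall e, 0 < e -> exists b, [/\ ~ E b, r <= normc (b - a) &
      normc (b - a) < r + e]].
Proof.
move=> EM /nbhs_discP[s s0 sE].
pose S := [set normc (b - a) | b in ~` E].
have S0 : S !=set0.
  have nE : ~ E (`|M| + 1)%:C.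
    move=> /EM; rewrite normc_real ger0_norm ?addr_ge0 // => h.
    by have := ler_norm M; lra.
  by exists (normc ((`|M| + 1)%:C - a)), (`|M| + 1)%:C.
have lbS : lbound S s.
  move=> _ [b nEb <-]; rewrite leNgt; apply/negP => h; apply: nEb; apply: sE.
  by rewrite open_discE normcBC.
have hS : has_inf S by split => //; exists s.
have infS b : ~ E b -> inf S <= normc (b - a).
  by move=> nEb; apply: ge_inf; [exists s|exists b].
exists (inf S); split.
- by apply: lt_le_trans s0 _; exact: lb_le_inf.
- move=> z; rewrite open_discE => h; apply: contrapT => /infS.
  by rewrite normcBC leNgt h.
- move=> e e0; have [_ [b nEb <-] be] := inf_adherent e0 hS.
  by exists b; split => //; exact: infS.
Qed.

Lemma derivable_cauchy_quotient a b z : z != b ->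
  derivable (cauchy_quotient a b) z 1.
Proof.
move=> zb; rewrite /cauchy_quotient; apply: derivableM.
  by apply: derivableB; [exact: derivable_id|exact: derivable_cst].
apply: derivableV; first by rewrite subr_eq0.
by apply: derivableB; [exact: derivable_id|exact: derivable_cst].
Qed.

Section Kernel.
Variables (Omega : set (cplx R)) (a : cplx R) (p M : R).
Hypotheses (oO : open Omega) (Oa : Omega a) (p0 : 0 < p).
Hypothesis OM : forall z, Omega z -> normc z <= M.
Hypothesis ker : bergman_kernel Omega p a = 1 / fine (area Omega).

Let mO : measurable (pre Omega). Proof. exact: measurable_open. Qed.
Let M0 : 0 <= M. Proof. exact: le_trans (normc_ge0 a) (OM Oa). Qed.

Lemma sub_square_of_bounded c (L : R) : M + normc c < L ->
  Omega `<=` open_square c L.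
Proof.
move=> ML z /OM zM; apply: sub_open_disc_square; rewrite open_discE.
by apply: le_lt_trans (normc_le_add _ _) _; rewrite normcN; lra.
Qed.

Lemma area_domain : (0 < area Omega < +oo)%E.
Proof.
apply/andP; split; first by apply: area_gt0 => //; exists a.
apply: (@area_fin _ Omega 0 (M + normc (0 : cplx R) + 1)) => //.
  by rewrite ltr_wpDl // addr_ge0 ?normc_ge0.
by apply: sub_square_of_bounded; rewrite ltrDl.
Qed.

Lemma dist_center_le z : Omega z -> normc (z - a) <= M + normc a.
Proof.
by move=> /OM zM; apply: le_trans (normc_le_add _ _) _; rewrite normcN lerD2r.
Qed.

(** For p < 2 the Cauchy quotient is p-integrable even with its pole on the
    boundary. *)
Lemma integral_le0_of_notin b : p < 2 -> ~ Omega b ->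
  \int[lebesgue2]_(u in pre Omega) Re (cauchy_quotient a b (cplx_of_pair u)) <= 0.
Proof.
move=> p2 Ob; pose L := M + normc a + normc b + 1.
have [na nb] := (normc_ge0 a, normc_ge0 b); have M0' := M0.
have L0 : 0 < L by rewrite /L; lra.
have int q : 0 < q < 2 -> lebesgue2.-integrable (pre Omega)
    (fun u => (normc (cauchy_quotient a b (cplx_of_pair u)) `^ q)%:E).
  move=> q02; apply: (integrable_cauchy_quotient_powR L0 q02 mO).
    by apply: sub_square_of_bounded; rewrite /L; lra.
  by move=> z /dist_center_le ?; rewrite /L; lra.
apply: (integral_Re_le0_of_kernel oO p0 area_domain ker).
- by move=> z Oz; apply: derivable_cauchy_quotient; apply/eqP => zb; rewrite -zb in Ob.
- by rewrite /cauchy_quotient subrr mul0r.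
- exact: cmeasurable_cauchy_quotient.
- by apply: int; apply/andP; split; lra.
- by apply: int; rewrite lt_max p0 /= gt_max p2 /=; lra.
Qed.

(** A pole off the closure makes the quotient bounded, hence p-integrable for
    every p. *)
Lemma integral_le0_of_notin_closure b : ~ closure Omega b ->
  \int[lebesgue2]_(u in pre Omega) Re (cauchy_quotient a b (cplx_of_pair u)) <= 0.
Proof.
move=> cOb.
have [s s0 sO] : exists2 s : R, 0 < s & forall z, Omega z -> s <= normc (z - b).
  have : exists2 V, nbhs b V & Omega `&` V = set0.
    apply: contrapT => h; apply: cOb => V bV.
    by apply/set0P/eqP => OV; apply: h; exists V.
  move=> [V /nbhs_discP[s s0 sV] OV]; exists s => // z Oz.
  rewrite leNgt; apply/negP => h; suff : (Omega `&` V) z by rewrite OV.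
  by split => //; apply: sV; rewrite open_discE normcBC.
have Aoo : (lebesgue2 (pre Omega) < +oo)%E by case/andP: area_domain.
have int q : 0 <= q -> lebesgue2.-integrable (pre Omega)
    (fun u => (normc (cauchy_quotient a b (cplx_of_pair u)) `^ q)%:E).
  move=> q0; apply: (integrable_bounded (M := ((M + normc a) / s) `^ q)) => //.
    by apply: measurable_normc_powR; exact: cmeasurable_cauchy_quotient.
  move=> u Ou; rewrite ger0_norm ?powR_ge0 //.
  have h : normc (cauchy_quotient a b (cplx_of_pair u)) <= (M + normc a) / s.
    rewrite normc_cauchy_quotient; apply: ler_pM; rewrite ?invr_ge0 ?normc_ge0 //.
      exact: dist_center_le.
    have su := sO _ Ou; rewrite lef_pV2 ?posrE //; exact: lt_le_trans su.
  apply: ge0_ler_powR => //; rewrite nnegrE ?normc_ge0 //.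
  by apply: le_trans h; exact: normc_ge0.
apply: (integral_Re_le0_of_kernel oO p0 area_domain ker).
- move=> z Oz; apply: derivable_cauchy_quotient; apply/eqP => zb.
  by apply: cOb; rewrite -zb; exact: subset_closure.
- by rewrite /cauchy_quotient subrr mul0r.
- exact: cmeasurable_cauchy_quotient.
- by apply: int; lra.
- by apply: int; rewrite le_max (ltW p0).
Qed.

End Kernel.

Lemma closed_disc_sub_closure a (r : R) E : 0 < r -> open_disc a r `<=` closure E ->
  closed_disc a r `<=` closure E.
Proof.
move=> r0 BE z; rewrite closed_discE normcBC => zr.
rewrite (iffLR (closure_id _) (@closed_closure _ E)).
move=> V /nbhs_discP[e e0 eV].
pose t := Num.min 1 (e / (2 * r)).
have t0 : 0 < t by rewrite lt_min ltr01 divr_gt0 // mulr_gt0.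
have t1 : t <= 1 by rewrite ge_min lexx.
have te : t * r < e.
  have : t * (2 * r) <= e by rewrite -ler_pdivlMr ?mulr_gt0 // ge_min lexx orbT.
  have : 0 < t * r by rewrite mulr_gt0.
  by move=> ? ?; lra.
pose w : cplx R := a + (1 - t)%:C * (z - a).
exists w; split.
- apply: BE; rewrite open_discE /w opprD addNKr normcN Normc.normcM normc_real.
  rewrite ger0_norm ?subr_ge0 //; apply: (@le_lt_trans _ _ ((1 - t) * r)).
    by rewrite ler_wpM2l ?subr_ge0.
  by rewrite gtr_pMl // ltrBlDr ltrDl.
- apply: eV; rewrite open_discE.
  have -> : z - w = t%:C * (z - a) by rewrite /w rmorphB rmorph1; ring.
  rewrite Normc.normcM normc_real gtr0_norm //; apply: le_lt_trans te.
  by rewrite ler_wpM2l // ltW.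
Qed.

Lemma open_sub_open_disc D a (r : R) : open D -> 0 < r ->
  D `<=` closed_disc a r -> D `<=` open_disc a r.
Proof.
move=> oD r0 Dr z Dz; have [e e0 eD] := iffLR (openP_disc D) oD _ Dz.
have := Dr _ Dz; rewrite open_discE closed_discE le_eqVlt => /orP[/eqP zr|//].
pose t := e / (2 * r); have t0 : 0 < t by rewrite divr_gt0 // mulr_gt0.
have tr : t * r < e.
  have : t * r = e / 2 by rewrite /t; field; rewrite gt_eqF.
  by move=> ->; lra.
pose w : cplx R := z + t%:C * (z - a).
have /Dr : D w.
  apply: eD; rewrite open_discE /w opprD addNKr normcN Normc.normcM normc_real.
  by rewrite gtr0_norm // normcBC zr.
rewrite closed_discE.
have -> : a - w = (1 + t)%:C * (a - z) by rewrite /w rmorphD rmorph1; ring.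
rewrite Normc.normcM normc_real zr gtr0_norm ?addr_gt0 //.
by rewrite ger_pMl // gerDl leNgt t0.
Qed.

End Conclusion.

Section Rigidity.
Context {R : realType}.
Implicit Types (a z : cplx R).

Lemma closure_normc_le (D : set (cplx R)) (M : R) :
  (forall z, D z -> normc z <= M) -> forall z, closure D z -> normc z <= M.
Proof.
move=> DM z cz; apply/ler_addgt0Pr => e e0.
have [w [Dw]] : D `&` open_disc z e !=set0 by apply: cz; apply/nbhs_discP; exists e.
rewrite open_discE => zw; have -> : z = w + (z - w) by rewrite addrC subrK.
by apply: le_trans (normc_le_add _ _) _; apply: lerD; [exact: DM|exact: ltW].
Qed.

(** The common end of both cases: E is the set, Omega itself or its closure,
    in which the disc is inscribed. *)
Lemma exists_disc_of_integral_le0 (Omega E : set (cplx R)) a (M : R) :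
  open Omega -> Omega a ->
  (forall z, E z -> normc z <= M) -> Omega `<=` E ->
  (forall r, open_disc a r `<=` E -> area (open_disc a r `\` Omega) = 0%E) ->
  (forall b, ~ E b -> \int[lebesgue2]_(u in pre Omega)
     Re (cauchy_quotient a b (cplx_of_pair u)) <= 0) ->
  exists r : R, [/\ 0 < r, open_disc a r `<=` E & Omega `<=` closed_disc a r].
Proof.
move=> oO Oa EM OE null int.
have [|r [r0 rE Hb]] := exists_inscribed_disc (a := a) EM.
  apply: filterS OE _; exact: open_nbhs_nbhs.
exists r; split => //.
have OM z : Omega z -> normc (z - a) <= M + normc a.
  by move=> /OE/EM zM; apply: le_trans (normc_le_add _ _) _; rewrite normcN lerD2r.
have M0 : 0 <= M + normc a by rewrite (le_trans (normc_ge0 _) (OM _ Oa)).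
apply: (sub_closed_disc_of_integral_le0 oO r0 M0 OM (null _ rE)) => e e0.
by have [b [nEb rb be]] := Hb _ e0; exists b; split => //; exact: int.
Qed.

End Rigidity.

Unset Implicit Arguments.

Theorem theorem1p12 (R : realType) (Omega : set (cplx R))
    (Omega_domain : domain Omega) (Omega_bounded : bounded_set Omega) :
  (forall (a : cplx R) (p : R), Omega a -> 0 < p < 2 ->
     bergman_kernel Omega p a = 1 / fine (area Omega) ->
     exists2 r : R, 0 < r & Omega = open_disc a r)
  /\
  (area ((closure Omega)° `\` Omega) = 0%E ->
   forall (a : cplx R) (p : R), Omega a -> 2 <= p ->
     bergman_kernel Omega p a = 1 / fine (area Omega) ->
     exists2 r : R, 0 < r & closure Omega = closed_disc a r).
Proof.
have [_ oO _] := Omega_domain.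
have [M _ OM] := bounded_normc Omega_bounded.
split=> [a p Oa /andP[p0 p2] ker|null a p Oa p2 ker].
  have [||b Ob|r [r0 rO Or]] := exists_disc_of_integral_le0 oO Oa OM.
  - by [].
  - move=> r rO; rewrite (_ : _ `\` _ = set0) ?/area ?preimage_set0 ?measure0 //.
    by apply/seteqP; split=> z // [/rO].
  - exact: (integral_le0_of_notin oO Oa p0 OM ker).
  exists r => //; apply/seteqP; split => //.
  exact: open_sub_open_disc.
have p0 : 0 < p by lra.
have [||b Ob|r [r0 rO Or]] :=
  exists_disc_of_integral_le0 oO Oa (closure_normc_le OM).
- exact: subset_closure.
- move=> r rO; apply/eqP; rewrite -measure_le0 -null; apply: le_area.
  + by apply: measurableD; apply: measurable_open => //; exact: open_open_disc.
  + by apply: measurableD; apply: measurable_open => //; exact: open_interior.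
  + move=> z [rz nOz]; split => //.
    have : open_disc a r `<=` (closure Omega)°.
      by rewrite -open_subsetE //; exact: open_open_disc.
    exact.
- exact: (integral_le0_of_notin_closure oO Oa p0 OM ker).
exists r => //; apply/seteqP; split; last exact: closed_disc_sub_closure.
move=> z cz; rewrite closed_discE; apply/ler_addgt0Pr => e e0.
have [w [/Or]] : Omega `&` open_disc z e !=set0.
  by apply: cz; apply/nbhs_discP; exists e.
rewrite closed_discE open_discE => aw zw.
have -> : a - z = (a - w) + (w - z) by ring.
apply: le_trans (normc_le_add _ _) _; rewrite [normc (w - z)]normcBC.
by apply: lerD => //; exact: ltW.
Qed.
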